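(* Let $k$ be a field and let $A$ be a fully bounded noetherian $k$-algebra. The following are equivalent: (a) $A$ is fully residually finite-dimensional; (b) $A$ is strongly residually finite-dimensional; (c) every simple left (equivalently, right) $A$-module is finite-dimensional over $k$; (d) every maximal (two-sided) ideal of $A$ has finite codimension in $A$. In particular, every affine noetherian PI $k$-algebra is fully residually finite-dimensional.
   Context: Algebras are unital and associative. An algebra is affine if it is finitely generated as a $k$-algebra; noetherian means left and right noetherian; PI means satisfying a polynomial identity. A prime ring is right (left) bounded if every essential right (left) ideal contains a nonzero two-sided ideal; a ring is fully bounded noetherian (FBN) if it is left and right noetherian and every prime factor ring is both left and right bounded. A $k$-algebra is residually finite-dimensional (RFD) if it is a subdirect product of finite-dimensional algebras, equivalently the intersection of its ideals of finite codimension is zero. $A$ is strongly residually finite-dimensional if $A/I$ is RFD for every two-sided ideal $I$ of $A$. $A$ is left (right) fully residually finite-dimensional if every finitely generated left (right) $A$-module is a subdirect product of finite-dimensional left (right) $A$-modules; $A$ is fully residually finite-dimensional if it is both left and right fully residually finite-dimensional. *)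

(* Defs.v *)
From HB Require Import structures.
From mathcomp Require Import all_boot all_algebra.
From mathcomp Require Import boolp classical_sets monalg.

Set Implicit Arguments.
Unset Strict Implicit.
Unset Printing Implicit Defensive.

Import GRing.Theory.

Local Open Scope classical_set_scope.
Local Open Scope quotient_scope.
Local Open Scope ring_scope.

(* Algebras are objects of algType k, hence nonzero.  Right-handed notions    *)
(* over A are the left-handed ones over the converse ring A^c; in particular  *)
(* lmodType A^c is the type of right A-modules.  MathComp gives A^c its ring  *)
(* structure; here it becomes a k-algebra, with the same scaling as A.        *)
Section ConverseAlgebra.
Variables (k : fieldType) (A : algType k).

Let scalec (c : k) (x : A^c) : A^c := c *: (x : A).

Let scalecA a b v : scalec a (scalec b v) = scalec (a * b) v.
Proof. exact: scalerA. Qed.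
Let scale0c v : scalec 0 v = 0.
Proof. exact: scale0r. Qed.
Let scale1c : left_id 1 scalec.
Proof. exact: scale1r. Qed.
Let scalecDr : right_distributive scalec +%R.
Proof. exact: scalerDr. Qed.
Let scalecDl v : {morph scalec^~ v : a b / a + b}.
Proof. by move=> a b; apply: scalerDl. Qed.

HB.instance Definition _ := GRing.Nmodule_isLSemiModule.Build k A^c
  scalecA scale0c scale1c scalecDr scalecDl.

Let scalecAl (a : k) (u v : A^c) : a *: (u * v) = (a *: u) * v.
Proof. exact: (@scalerAr k A). Qed.

HB.instance Definition _ :=
  GRing.LSemiModule_isLSemiAlgebra.Build k A^c scalecAl.

Let scalecAr (a : k) (u v : A^c) : a *: (u * v) = u * (a *: v).
Proof. exact: (@scalerAl k A). Qed.

HB.instance Definition _ :=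
  GRing.LSemiAlgebra_isSemiAlgebra.Build k A^c scalecAr.

End ConverseAlgebra.

Section Rings.
Variable R : nzRingType.

Definition submodule (M : lmodType R) (N : set M) : Prop :=
  N 0 /\ forall a u v, N u -> N v -> N (a *: u + v).

Definition fg_module (M : lmodType R) : Prop :=
  exists (n : nat) (g : 'I_n -> M),
    forall x, exists c : 'I_n -> R, x = \sum_(i < n) c i *: g i.

Definition simple_module (M : lmodType R) : Prop :=
  (exists x : M, x <> 0) /\
  forall N : set M, submodule N -> N = [set 0] \/ N = setT.

Definition left_ideal (I : set R) : Prop := @submodule R^o I.

End Rings.

Definition right_ideal (R : nzRingType) (I : set R) : Prop :=
  @left_ideal R^c I.

Definition two_sided_ideal (R : nzRingType) (I : set R) : Prop :=
  left_ideal I /\ right_ideal I.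

Definition left_noetherian (R : nzRingType) : Prop :=
  forall I : nat -> set R,
    (forall n, left_ideal (I n)) -> (forall n, I n `<=` I n.+1) ->
    exists n, forall m, (n <= m)%N -> I m = I n.

Definition right_noetherian (R : nzRingType) : Prop := left_noetherian R^c.

Definition noetherian (R : nzRingType) : Prop :=
  left_noetherian R /\ right_noetherian R.

Definition essential_left_ideal (R : nzRingType) (E : set R) : Prop :=
  left_ideal E /\
  forall J : set R, left_ideal J -> J <> [set 0] -> E `&` J <> [set 0].

Definition left_bounded (R : nzRingType) : Prop :=
  forall E : set R, essential_left_ideal E ->
    exists I : set R, [/\ two_sided_ideal I, I <> [set 0] & I `<=` E].

Definition right_bounded (R : nzRingType) : Prop := left_bounded R^c.

Definition prime_ring (R : nzRingType) : Prop :=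
  forall I J : set R, two_sided_ideal I -> two_sided_ideal J ->
    (forall x y, I x -> J y -> x * y = 0) -> I = [set 0] \/ J = [set 0].

(* Properness makes the quotient a nonzero ring, as algType requires.  The    *)
(* excluded quotient A/A is the zero algebra: it is finite-dimensional, hence *)
(* residually finite-dimensional, and it is not a prime ring.                 *)
Record proper_two_sided (R : nzRingType) := ProperIdeal {
  ideal_set :> set R;
  ideal_two_sided : two_sided_ideal ideal_set;
  ideal_proper : ~ ideal_set 1
}.

(* The factor algebra A/I, on top of the additive quotient of ring_quotient.  *)
Section QuotientAlgebra.
Variables (k : fieldType) (A : algType k) (I : proper_two_sided A).

Definition ideal_pred : {pred A} := fun x => `[< ideal_set I x >].

Let ideal_predP x : reflect (ideal_set I x) (x \in ideal_pred).
Proof. exact: asboolP. Qed.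

Let ideal_pred_zmod : zmod_closed ideal_pred.
Proof.
case: (ideal_two_sided I) => -[I0 IL] _.
split=> [|x y /ideal_predP Ix /ideal_predP Iy]; apply/ideal_predP => //.
by have := IL (-1) y x Iy Ix; rewrite scaleN1r addrC.
Qed.

HB.instance Definition _ := GRing.isZmodClosed.Build A ideal_pred
  ideal_pred_zmod.

Let idealMl a x : x \in ideal_pred -> a * x \in ideal_pred.
Proof.
case: (ideal_two_sided I) => -[I0 IL] _ /ideal_predP Ix; apply/ideal_predP.
by have := IL a x 0 Ix I0; rewrite addr0.
Qed.

Let idealMr a x : x \in ideal_pred -> x * a \in ideal_pred.
Proof.
case: (ideal_two_sided I) => _ [I0 IR] /ideal_predP Ix; apply/ideal_predP.
by have := IR a x 0 Ix I0; rewrite addr0.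
Qed.

Definition quot_alg : Type := Quotient.quot ideal_pred.

HB.instance Definition _ := GRing.Zmodule.on quot_alg.
HB.instance Definition _ := EqQuotient.on quot_alg.

Definition quot_one : quot_alg := \pi_quot_alg 1.
Definition quot_mul : quot_alg -> quot_alg -> quot_alg :=
  lift_op2 quot_alg *%R.
Definition quot_scale (c : k) : quot_alg -> quot_alg :=
  lift_op1 quot_alg ( *:%R c).

Lemma quot_eqP (x y : A) :
  reflect (\pi_quot_alg x = \pi_quot_alg y) (x - y \in ideal_pred).
Proof. by rewrite Quotient.idealrBE; apply: eqP. Qed.

Lemma quot_piD (x y : A) :
  \pi_quot_alg (x + y) = \pi_quot_alg x + \pi_quot_alg y.
Proof. by rewrite [RHS]piE. Qed.

Lemma quot_mulE (x y : A) :
  quot_mul (\pi_quot_alg x) (\pi_quot_alg y) = \pi_quot_alg (x * y).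
Proof.
unlock quot_mul; apply/quot_eqP; set x' := repr _; set y' := repr _.
have Hx : x' - x \in ideal_pred by apply/quot_eqP; rewrite reprK.
have Hy : y' - y \in ideal_pred by apply/quot_eqP; rewrite reprK.
have -> : x' * y' - x * y = (x' - x) * y' + x * (y' - y).
  by rewrite mulrBl mulrBr addrA subrK.
by apply: rpredD; [apply: idealMr | apply: idealMl].
Qed.

Lemma quot_scaleE (c : k) (x : A) :
  quot_scale c (\pi_quot_alg x) = \pi_quot_alg (c *: x).
Proof.
unlock quot_scale; apply/quot_eqP; set x' := repr _.
have Hx : x' - x \in ideal_pred by apply/quot_eqP; rewrite reprK.
by rewrite -scalerBr -[x' - x]mul1r scalerAl idealMl.
Qed.

Let mulqA : associative quot_mul.
Proof.
by move=> x y z; rewrite -[x]reprK -[y]reprK -[z]reprK !quot_mulE mulrA.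
Qed.
Let mul1q : left_id quot_one quot_mul.
Proof. by move=> x; rewrite -[x]reprK quot_mulE mul1r. Qed.
Let mulq1 : right_id quot_one quot_mul.
Proof. by move=> x; rewrite -[x]reprK quot_mulE mulr1. Qed.
Let mulqDl : left_distributive quot_mul +%R.
Proof.
move=> x y z; rewrite -[x]reprK -[y]reprK -[z]reprK.
by rewrite -quot_piD !quot_mulE -quot_piD mulrDl.
Qed.
Let mulqDr : right_distributive quot_mul +%R.
Proof.
move=> x y z; rewrite -[x]reprK -[y]reprK -[z]reprK.
by rewrite -quot_piD !quot_mulE -quot_piD mulrDr.
Qed.
Let quot1_neq0 : quot_one != 0.
Proof.
apply/negP => /eqP; have -> : (0 : quot_alg) = \pi_quot_alg 0 by rewrite piE.
by move/quot_eqP; rewrite subr0 => /ideal_predP; apply: ideal_proper.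
Qed.

HB.instance Definition _ := GRing.Zmodule_isNzRing.Build quot_alg
  mulqA mul1q mulq1 mulqDl mulqDr quot1_neq0.

Let scaleqA a b (v : quot_alg) :
  quot_scale a (quot_scale b v) = quot_scale (a * b) v.
Proof. by rewrite -[v]reprK !quot_scaleE scalerA. Qed.
Let scale1q : left_id 1 quot_scale.
Proof. by move=> v; rewrite -[v]reprK quot_scaleE scale1r. Qed.
Let scaleqDr : right_distributive quot_scale +%R.
Proof.
move=> a x y; rewrite -[x]reprK -[y]reprK.
by rewrite -quot_piD !quot_scaleE -quot_piD scalerDr.
Qed.
Let scaleqDl (v : quot_alg) : {morph quot_scale^~ v : a b / a + b}.
Proof.
by move=> a b; rewrite -[v]reprK !quot_scaleE -quot_piD scalerDl.
Qed.

HB.instance Definition _ := GRing.Zmodule_isLmodule.Build k quot_alg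
  scaleqA scale1q scaleqDr scaleqDl.

Let scaleqAl (a : k) (u v : quot_alg) : a *: (u * v) = (a *: u) * v.
Proof.
rewrite -[u]reprK -[v]reprK /GRing.scale /GRing.mul /=.
by rewrite quot_mulE !quot_scaleE quot_mulE scalerAl.
Qed.

HB.instance Definition _ :=
  GRing.LSemiModule_isLSemiAlgebra.Build k quot_alg scaleqAl.

Let scaleqAr (a : k) (u v : quot_alg) : a *: (u * v) = u * (a *: v).
Proof.
rewrite -[u]reprK -[v]reprK /GRing.scale /GRing.mul /=.
by rewrite quot_mulE !quot_scaleE quot_mulE scalerAr.
Qed.

HB.instance Definition _ :=
  GRing.LSemiAlgebra_isSemiAlgebra.Build k quot_alg scaleqAr.

End QuotientAlgebra.

Definition fully_bounded_noetherian (k : fieldType) (A : algType k) : Prop :=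
  noetherian A /\
  forall P : proper_two_sided A, prime_ring (quot_alg P) ->
    left_bounded (quot_alg P) /\ right_bounded (quot_alg P).

Definition maximal_ideal (R : nzRingType) (I : proper_two_sided R) : Prop :=
  forall J : set R, two_sided_ideal J -> I `<=` J ->
    J = ideal_set I \/ J = setT.

Section RestrictionOfScalars.
Variables (k : fieldType) (A : algType k) (M : lmodType A).

Definition restrict_scalars : Type := M.

HB.instance Definition _ := GRing.Zmodule.on restrict_scalars.

Let scalek (c : k) (x : restrict_scalars) : restrict_scalars :=
  (c%:A : A) *: (x : M).

Let scalekA a b v : scalek a (scalek b v) = scalek (a * b) v.
Proof. by rewrite /scalek scalerA -scalerAl mul1r scalerA. Qed.
Let scale1k : left_id 1 scalek.
Proof. by move=> v; rewrite /scalek !scale1r. Qed.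
Let scalekDr : right_distributive scalek +%R.
Proof. by move=> c u v; apply: scalerDr. Qed.
Let scalekDl v : {morph scalek^~ v : a b / a + b}.
Proof. by move=> a b; rewrite /scalek !scalerDl. Qed.

HB.instance Definition _ := GRing.Zmodule_isLmodule.Build k restrict_scalars
  scalekA scale1k scalekDr scalekDl.

End RestrictionOfScalars.

Definition fin_dim (k : fieldType) (V : lmodType k) : Prop :=
  exists n : nat, inhabited (Vector.axiom n V).

Definition fin_dim_module (k : fieldType) (A : algType k) (M : lmodType A) :=
  fin_dim (restrict_scalars M).

Section ResiduallyFiniteDimensional.
Variable k : fieldType.
Implicit Type A : algType k.

(* Subdirect product: the projections are onto and jointly injective.         *)
Definition residually_fin_dim A : Prop :=
  exists (T : Type) (B : T -> algType k) (f : forall t, {lrmorphism A -> B t}),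
    [/\ forall t, fin_dim (B t),
        forall t (y : B t), exists x, f t x = y
      & forall x, (forall t, f t x = 0) -> x = 0].

Definition strongly_residually_fin_dim A : Prop :=
  forall I : proper_two_sided A, residually_fin_dim (quot_alg I).

Definition residually_fin_dim_module A (M : lmodType A) : Prop :=
  exists (T : Type) (N : T -> lmodType A) (f : forall t, {linear M -> N t}),
    [/\ forall t, fin_dim_module (N t),
        forall t (y : N t), exists x, f t x = y
      & forall x, (forall t, f t x = 0) -> x = 0].

Definition left_fully_residually_fin_dim A : Prop :=
  forall M : lmodType A, fg_module M -> residually_fin_dim_module M.

Definition right_fully_residually_fin_dim A : Prop :=
  left_fully_residually_fin_dim A^c.

Definition fully_residually_fin_dim A : Prop :=
  left_fully_residually_fin_dim A /\ right_fully_residually_fin_dim A.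

Definition subalgebra A (S : set A) : Prop :=
  [/\ S 1,
      forall (c : k) u v, S u -> S v -> S (c *: u + v)
    & forall u v, S u -> S v -> S (u * v)].

Definition affine A : Prop :=
  exists g : seq A, forall S : set A,
    subalgebra S -> (forall x, x \in g -> S x) -> S = setT.

(* {malg k[{fmonom nat}]} is the free algebra on noncommuting variables       *)
(* indexed by nat, i.e. the monoid algebra of words.                          *)
Definition polynomial_identity A : Prop :=
  exists2 p : {malg k[{fmonom nat}]}, p != 0 &
    forall a : nat -> A,
      mmap (in_alg A) (fun w : {fmonom nat} => \prod_(i <- (w : seq nat)) a i) p
        = 0.

End ResiduallyFiniteDimensional.

(* Main.v *)
(* Both parts rest on one statement about a left noetherian algebra A:        *)
(* (N) if all nonzero submodules of A/L have the same annihilator P, then L/P *)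
(* is not an essential left ideal of A/P.  Boundedness of A/P gives (N),      *)
(* since an ideal contained in L annihilates A/L.  Suppose that simple left   *)
(* modules are finite-dimensional.  A finitely generated module is a subdirect*)
(* product of quotients U with an essential simple submodule.  If F is a      *)
(* maximal finite-dimensional submodule of such a U and F <> U, choose v      *)
(* outside F with P = ann((Av + F)/F) maximal.  As P is finitely generated    *)
(* and Pv lies in F, the left ideal {a | Pav = 0} has finite codimension, so  *)
(* w = av is outside F for some such a; then Pw = 0, and (N), applied to      *)
(* L = {x | xw in F}, produces a nonzero submodule Jw meeting F trivially,    *)
(* against essentiality.                                                      *)
(*                                                                            *)
(* For PI algebras (N) follows from a degree reduction: if a left ideal E     *)
(* satisfies a multilinear identity modulo P and Eu <> 0, then E n ann(u)     *)
(* satisfies one of smaller degree, so some finite intersection of            *)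
(* annihilators of elements is P.  The same reduction over a maximal          *)
(* commutative subfield K of End_A(M), with a density argument, shows that a  *)
(* simple module M is finite-dimensional over K.  If A is moreover affine,    *)
(* the K-basis spans an A-stable lattice over the ring generated by the       *)
(* structure constants; by simplicity this lattice is M and this ring is K,   *)
(* and Zariski's lemma makes K finite over k.                                 *)

Require Import Defs.
From HB Require Import structures.
From mathcomp Require Import all_boot all_algebra.
From mathcomp Require Import boolp classical_sets finmap monalg.

Set Implicit Arguments.
Unset Strict Implicit.
Unset Printing Implicit Defensive.

Import GRing.Theory.

Local Open Scope classical_set_scope.
Local Open Scope ring_scope.

(** * Spans and subspaces of finite codimension *)

(** The equivalences are closed into a cycle in which (d), being left-right symmetric, is the bridge
    between left and right simple modules; right-handed statements are the left-handed ones over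
    [A^c]. (a) gives (b) because [A/I] is a cyclic left module and the annihilator of a
    finite-dimensional image of it is an ideal of finite codimension ([left_fully_strongly_rfd]).
    (b) gives (d) because a nonzero quotient of a simple algebra is the algebra itself
    ([strongly_rfd_max_two_sided]). (c) gives (d) because a maximal ideal is the annihilator of a
    simple module ([max_left_max_two_sided]). (d) gives (c) because, by (N), the annihilator of a
    simple module is a maximal ideal ([max_two_sided_max_left]). (c) gives (a) by [left_fully_rfd],
    whose core is [essential_fin_dim]. Boundedness enters only through (N), in
    [bounded_faithful_nonessential].

    The affine PI case feeds [left_fully_rfd] directly on both sides: (N) comes from
    [pi_faithful_nonessential], and the finite dimension of simple modules from
    [affine_pi_simple_fin_dim]. Both rest on the degree reduction [opol_annihilator]; the second
    also needs [opgen_density], [irreducible_scalars_generated] and [zariski]. *)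

Definition subring_set (R : nzRingType) (S : set R) : Prop :=
  [/\ S 1, forall x y, S x -> S y -> S (x - y)
    & forall x y, S x -> S y -> S (x * y)].

Lemma subring_setT (R : nzRingType) : subring_set [set: R].
Proof. by []. Qed.

Lemma subrACA (V : zmodType) (x y z t : V) :
  (x - y) - (z - t) = (x - z) - (y - t).
Proof. by rewrite opprD addrACA -opprD. Qed.

Section Span.
Variables (R : nzRingType) (V : lmodType R).
Implicit Types (C : set R) (e : seq V) (N : set V).

(** The scalars range over a subset [C] so that one notion covers submodules ([C = setT]) and
    lattices over a subring of a field. *)
Definition stable C N : Prop :=
  [/\ N 0, forall x y, N x -> N y -> N (x - y)
    & forall c x, C c -> N x -> N (c *: x)].

Lemma stableD C N x y : stable C N -> N x -> N y -> N (x + y).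
Proof.
case=> N0 NB _ Nx Ny; rewrite -[y]opprK; apply: (NB) => //.
by rewrite -sub0r; apply: NB.
Qed.

Lemma submoduleP N : submodule N <-> stable setT N.
Proof.
split=> [[N0 NL]|[N0 NB NZ]].
  split=> // [x y Nx Ny|c x _ Nx].
    by rewrite addrC -scaleN1r; apply: NL.
  by rewrite -[_ *: _]addr0; apply: NL.
split=> // a u v Nu Nv; apply: (@stableD setT) => //.
by apply: NZ.
Qed.

Fixpoint span C e : set V :=
  if e is v :: e' then [set x | exists2 c, C c & span C e' (x - c *: v)]
  else [set 0].

Lemma span_stable C e : subring_set C -> stable C (span C e).
Proof.
move=> [C1 CB CM]; have C0 : C 0 by rewrite -(subrr 1); apply: CB.
elim: e => [|v e [IH0 IHB IHZ]] /=.
  by split=> [//|x y -> ->|c x _ ->]; rewrite ?subrr ?scaler0.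
split=> [|x y [a Ca Hx] [b Cb Hy]|c x Cc [a Ca Hx]].
- by exists 0; rewrite // scale0r subr0.
- exists (a - b); first exact: CB.
  by rewrite scalerBl subrACA; apply: IHB.
- exists (c * a); first exact: CM.
  by rewrite -scalerA -scalerBr; apply: IHZ.
Qed.

Lemma span_ind C e N : N 0 -> (forall x y, N x -> N y -> N (x + y)) ->
  (forall c v, C c -> v \in e -> N (c *: v)) -> span C e `<=` N.
Proof.
move=> N0 ND; elim: e => [|v e IHe] Ne x /=; first by move=> ->.
move=> [c Cc Hx]; rewrite -[x](subrK (c *: v)).
apply: (ND); last by apply: Ne; rewrite ?mem_head.
by apply: IHe Hx => b w Cb we; apply: Ne; rewrite // inE we orbT.
Qed.

Lemma span_min C e N : stable C N -> (forall v, v \in e -> N v) ->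
  span C e `<=` N.
Proof.
move=> sN Ne; have [N0 _ NZ] := sN; apply: span_ind => // [x y|c v Cc /Ne].
  exact: stableD sN.
exact: NZ.
Qed.

Lemma mem_span C e v : subring_set C -> v \in e -> span C e v.
Proof.
move=> sC; have [C1 CB _] := sC.
elim: e => //= w e IHe; rewrite inE => /predU1P[->|ve].
  by exists 1; rewrite // scale1r subrr; case: (span_stable e sC).
by exists 0; [rewrite -(subrr 1); apply: CB | rewrite scale0r subr0; apply: IHe].
Qed.

Lemma sub_span C e1 e2 : subring_set C ->
  (forall v, v \in e1 -> span C e2 v) -> span C e1 `<=` span C e2.
Proof. by move=> sC; apply: span_min; apply: span_stable. Qed.

Lemma span_sumP C n (g : 'I_n -> V) x : subring_set C ->
  span C [seq g i | i <- enum 'I_n] x <->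
  exists2 c : 'I_n -> R, forall i, C (c i) & x = \sum_(i < n) c i *: g i.
Proof.
move=> sC; have [C1 CB CM] := sC; have C0 : C 0 by rewrite -(subrr 1); apply: CB.
split; last first.
  move=> [c Cc ->]; have sS := span_stable [seq g i | i <- enum 'I_n] sC.
  elim/big_ind: _ => [|y z|i _]; [by case: sS | exact: stableD sS | ].
  have [_ _ SZ] := sS; apply: SZ => //; apply: mem_span => //.
  by apply/mapP; exists i; rewrite ?mem_enum.
move: x; apply: (@span_min _ _ [set x | exists2 c : 'I_n -> R,
  forall i, C (c i) & x = \sum_(i < n) c i *: g i]) => [|v /mapP[i _ ->]].
  split=> [|_ _ [c Cc ->] [d Cd ->]|a _ Ca [c Cc ->]].
  - by exists (fun=> 0) => //; rewrite big1 // => i _; rewrite scale0r.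
  - exists (fun i => c i - d i) => [i|]; first exact: CB.
    by rewrite -sumrB; apply: eq_bigr => i _; rewrite scalerBl.
  - exists (fun i => a * c i) => [i|]; first exact: CM.
    by rewrite scaler_sumr; apply: eq_bigr => i _; rewrite scalerA.
exists (fun j => if j == i then 1 else 0) => [j|]; first by case: ifP.
rewrite (bigD1 i) //= eqxx scale1r big1 ?addr0 // => j /negPf ->.
by rewrite scale0r.
Qed.

End Span.

(** A spanning family of least length is independent, since a nontrivial relation would eliminate a
    generator. [C] is a subfield of [K]; span and independence are both taken over [C]. *)
Lemma exists_basis (K : fieldType) (V : lmodType K) (C : set K) (e : seq V) :
    subring_set C -> (forall x, C x -> C x^-1) -> (forall x, span C e x) ->
  exists (n : nat) (g : 'I_n -> V),
    (forall x, exists2 c : 'I_n -> K,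
       forall i, C (c i) & x = \sum_(i < n) c i *: g i) /\
    (forall c : 'I_n -> K, (forall i, C (c i)) ->
       \sum_(i < n) c i *: g i = 0 -> forall i, c i = 0).
Proof.
move=> sC CV He; have [C1 CB CM] := sC.
have C0 : C 0 by rewrite -(subrr 1); apply: CB.
pose spans n := `[< exists g : 'I_n -> V, forall x, exists2 c : 'I_n -> K,
  forall i, C (c i) & x = \sum_(i < n) c i *: g i >].
have exn : exists n, spans n.
  exists (size e); apply/asboolP; exists (fun i => e`_i) => x.
  apply/span_sumP => //.
  by rewrite (map_comp (nth 0 e) val) val_enum_ord map_nth_iota0 ?take_size.
case: (ex_minnP exn) => n /asboolP[g Hg] nmin; exists n, g; split=> // d Cd Ed i.
apply: contrapT => /eqP di0; case: n => [|m] in g Hg nmin d Cd Ed i di0 *.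
  by case: i {di0}.
suff /nmin : spans m by rewrite ltnn.
apply/asboolP; exists (fun j => g (lift i j)) => x.
have [c Cc Ex] := Hg x.
(* Subtract the multiple of the relation that cancels the coefficient of [g i]. *)
exists (fun j => c (lift i j) - c i / d i * d (lift i j)) => [j|].
  by apply: CB => //; apply: (CM) => //; apply: (CM) => //; apply: CV.
have -> : x = \sum_(j < m.+1) (c j - c i / d i * d j) *: g j.
  transitivity (x - (c i / d i) *: (\sum_(j < m.+1) d j *: g j)).
    by rewrite Ed scaler0 subr0.
  rewrite {1}Ex scaler_sumr -sumrB; apply: eq_bigr => j _.
  by rewrite scalerBl scalerA.
by rewrite (bigD1_ord i) //= divfK // subrr scale0r add0r.
Qed.

Section FiniteCodimension.
Variable k : fieldType.

Definition fin_codim (V : lmodType k) (N : set V) : Prop :=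
  exists e : seq V, forall x, exists2 s, span setT e s & N (x - s).

Lemma fin_codimS (V : lmodType k) (N N' : set V) :
  N `<=` N' -> fin_codim N -> fin_codim N'.
Proof. by move=> sN [e He]; exists e => x; have [s] := He x; exists s; auto. Qed.

Lemma fin_codimT (V : lmodType k) : fin_codim [set: V].
Proof. by exists [::] => x; exists 0. Qed.

(* The image of N1 in V / N is spanned by e; the vectors of e are cut off one *)
(* at a time, each lowering the dimension of that image by at most 1.         *)
Lemma fin_codim_preimage (V W : lmodType k) (phi : V -> W) (N1 : set V)
    (N : set W) (e : seq W) :
    (forall c x y, phi (c *: x + y) = c *: phi x + phi y) ->
    stable setT N -> stable setT N1 -> fin_codim N1 ->
    (forall x, N1 x -> exists2 s, span setT e s & N (phi x - s)) ->
  fin_codim [set x | N1 x /\ N (phi x)].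
Proof.
move=> phiL sN; have sT := subring_setT k.
have phiZ c x : phi (c *: x) = c *: phi x.
  have phi0 : phi 0 = 0.
    by apply: (@addrI _ (phi 0)); rewrite -{1}[phi 0]scale1r -phiL scaler0 addr0
                                          addr0.
  by rewrite -[c *: x]addr0 phiL phi0 addr0.
have phiB x y : phi (x - y) = phi x - phi y.
  by rewrite addrC -scaleN1r phiL scaleN1r addrC.
elim: e N1 => [|v e IHe] N1 sN1 fN1 HN1.
  apply: fin_codimS fN1 => x N1x; split=> //.
  by have [_ ->] := HN1 x N1x; rewrite subr0.
pose N2 := [set x | N1 x /\ exists2 s, span setT e s & N (phi x - s)].
have sE := span_stable e sT.
have [N0 NB NZ] := sN; have [N10 N1B N1Z] := sN1; have [E0 EB EZ] := sE.
have sN2 : stable setT N2.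
  split=> [|x y [N1x [s es Ns]] [N1y [t et Nt]]|c x _ [N1x [s es Ns]]].
  - by split=> //; exists 0; rewrite // subr0 -(scale0r (0 : V)) phiZ scale0r.
  - split; [exact: N1B | exists (s - t); first exact: EB].
    by rewrite phiB subrACA; apply: NB.
  - split; [exact: N1Z | exists (c *: s); first exact: EZ].
    by rewrite phiZ -scalerBr; apply: NZ.
have fN2 : fin_codim N2.
  have [sub12|] := pselect (N1 `<=` N2); first exact: fin_codimS fN1.
  move=> /existsNP[x0 /not_implyP[N1x0 N2x0]].
  have [s0 [c0 _ es0] Ns0] := HN1 _ N1x0.
  have c0n : c0 != 0.
    apply/eqP => c00; apply: N2x0; split=> //; exists s0 => //.
    by move: es0; rewrite c00 scale0r subr0.
  have [f Hf] := fN1; exists (x0 :: f) => x.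
  have [t ft N1t] := Hf x; have [s [c _ es] Ns] := HN1 _ N1t.
  (* [x0] spans [N1] modulo [N2]: this multiple of it cancels the coefficient of [v]. *)
  exists (t + (c / c0) *: x0); first by exists (c / c0); rewrite // addrK.
  rewrite opprD addrA; split; first by apply: N1B => //; apply: N1Z.
  exists ((s - c *: v) - (c / c0) *: (s0 - c0 *: v)).
    by apply: EB => //; apply: (EZ _ _ I).
  have -> : phi (x - t - (c / c0) *: x0) -
              (s - c *: v - (c / c0) *: (s0 - c0 *: v)) =
            (phi (x - t) - s) - (c / c0) *: (phi x0 - s0).
    rewrite phiB phiZ !scalerBr scalerA divfK //.
    by rewrite [s - _ - _]subrACA subrr subr0 subrACA.
  by apply: NB => //; apply: NZ.
apply: fin_codimS (IHe N2 sN2 fN2 _) => [x [[]]|x []] //.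
Qed.

Lemma fin_codim_preimages (T : eqType) (V W : lmodType k) (phi : T -> V -> W)
    (N : set W) (e : seq W) (ps : seq T) :
    stable setT N ->
    (forall p c x y, phi p (c *: x + y) = c *: phi p x + phi p y) ->
    (forall p x, p \in ps -> exists2 s, span setT e s & N (phi p x - s)) ->
  fin_codim [set x | forall p, p \in ps -> N (phi p x)].
Proof.
move=> sN phiL; elim: ps => [|p ps IHp] He.
  by apply: fin_codimS (fin_codimT V).
have fN : fin_codim [set x | forall q, q \in ps -> N (phi q x)].
  by apply: IHp => q x qps; apply: He; rewrite inE qps orbT.
have [N0 NB NZ] := sN.
have phi0 q : phi q 0 = 0.
  by have := phiL q (-1) 0 0; rewrite scaler0 addr0 scaleN1r addNr.
apply: fin_codimS (fin_codim_preimage (phiL p) sN _ fN _) => /= [x [Hx Hp] q||].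
- by rewrite inE => /predU1P[->|/Hx].
- split=> [q _|x y Hx Hy q qps|c x _ Hx q qps]; first by rewrite phi0.
    have -> : x - y = (-1) *: y + x by rewrite scaleN1r addrC.
    by rewrite phiL scaleN1r addrC; apply: NB; [apply: Hx | apply: Hy].
  by rewrite -[c *: x]addr0 phiL phi0 addr0; apply: NZ => //; apply: Hx.
by move=> x _; apply: He; rewrite mem_head.
Qed.

End FiniteCodimension.

(** * Quotient modules *)

Record submod (R : nzRingType) (M : lmodType R) := Submod {
  submod_set :> set M;
  submodP : submodule submod_set
}.

Section QuotientModule.
Local Open Scope quotient_scope.
Variables (R : nzRingType) (M : lmodType R) (N : submod M).

Definition submod_pred : {pred M} := fun x => `[< submod_set N x >].

Lemma submod_predP x : reflect (submod_set N x) (x \in submod_pred).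
Proof. exact: asboolP. Qed.

Let submod_zmod : zmod_closed submod_pred.
Proof.
have [N0 NB _] := (submoduleP N).1 (submodP N).
split=> [|x y /submod_predP Nx /submod_predP Ny]; apply/submod_predP => //.
exact: NB.
Qed.

HB.instance Definition _ := GRing.isZmodClosed.Build M submod_pred submod_zmod.

Definition quot_mod : Type := Quotient.quot submod_pred.

HB.instance Definition _ := GRing.Zmodule.on quot_mod.
HB.instance Definition _ := EqQuotient.on quot_mod.

Definition quot_mod_scale (a : R) : quot_mod -> quot_mod :=
  lift_op1 quot_mod ( *:%R a).

Lemma quot_mod_eqP (x y : M) : \pi_quot_mod x = \pi_quot_mod y <-> submod_set N (x - y).
Proof.
split=> [/eqP|/submod_predP Nxy]; last by apply/eqP; rewrite -Quotient.idealrBE.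
by rewrite -Quotient.idealrBE => /submod_predP.
Qed.

Lemma quot_mod_piD (x y : M) :
  \pi_quot_mod (x + y) = \pi_quot_mod x + \pi_quot_mod y.
Proof. by rewrite [RHS]piE. Qed.

Lemma quot_mod_scaleE (a : R) (x : M) :
  quot_mod_scale a (\pi_quot_mod x) = \pi_quot_mod (a *: x).
Proof.
unlock quot_mod_scale; apply/quot_mod_eqP; rewrite -scalerBr.
have [_ _ NZ] := (submoduleP N).1 (submodP N); apply: NZ => //.
by apply/quot_mod_eqP; rewrite reprK.
Qed.

Let scalemA a b (v : quot_mod) :
  quot_mod_scale a (quot_mod_scale b v) = quot_mod_scale (a * b) v.
Proof. by rewrite -[v]reprK !quot_mod_scaleE scalerA. Qed.
Let scale1m : left_id 1 quot_mod_scale.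
Proof. by move=> v; rewrite -[v]reprK quot_mod_scaleE scale1r. Qed.
Let scalemDr : right_distributive quot_mod_scale +%R.
Proof.
move=> a x y; rewrite -[x]reprK -[y]reprK.
by rewrite -quot_mod_piD !quot_mod_scaleE -quot_mod_piD scalerDr.
Qed.
Let scalemDl (v : quot_mod) : {morph quot_mod_scale^~ v : a b / a + b}.
Proof.
by move=> a b; rewrite -[v]reprK !quot_mod_scaleE -quot_mod_piD scalerDl.
Qed.

HB.instance Definition _ := GRing.Zmodule_isLmodule.Build R quot_mod
  scalemA scale1m scalemDr scalemDl.

Definition mod_pi (x : M) : quot_mod := \pi_quot_mod x.

Lemma mod_pi_linear : linear mod_pi.
Proof. by move=> a x y; rewrite /mod_pi quot_mod_piD -quot_mod_scaleE. Qed.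

HB.instance Definition _ := GRing.isLinear.Build R M quot_mod *:%R mod_pi
  mod_pi_linear.

Lemma mod_piZ a x : mod_pi (a *: x) = a *: mod_pi x.
Proof. by rewrite /mod_pi -quot_mod_scaleE. Qed.

Lemma mod_pi_surj (y : quot_mod) : exists x, mod_pi x = y.
Proof. by exists (repr y); rewrite /mod_pi reprK. Qed.

Lemma mod_pi_eq0 (x : M) : mod_pi x = 0 <-> submod_set N x.
Proof. by rewrite -(raddf0 mod_pi) quot_mod_eqP subr0. Qed.

End QuotientModule.

(** * Noetherian rings and modules *)

Definition acc (T : Type) (Q : set (set T)) : Prop :=
  forall I : nat -> set T, (forall n, Q (I n)) -> (forall n, I n `<=` I n.+1) ->
    exists n, forall m, (n <= m)%N -> I m = I n.

Lemma chain_sub (T : Type) (I : nat -> set T) :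
  (forall n, I n `<=` I n.+1) -> forall m n, (m <= n)%N -> I m `<=` I n.
Proof.
move=> sI m; elim=> [|n IHn]; first by rewrite leqn0 => /eqP ->.
by rewrite leq_eqVlt => /predU1P[<- //|/IHn mn x /mn]; apply: sI.
Qed.

(** Without a maximal member above [X0], dependent choice would build a strictly increasing chain.
    Applied to families of annihilators, this replaces finite generation of ideals. *)
Lemma acc_max (T : Type) (Q F : set (set T)) X0 :
    acc Q -> F `<=` Q -> F X0 ->
  exists2 X, F X /\ X0 `<=` X & forall Y, F Y -> X `<=` Y -> Y `<=` X.
Proof.
move=> accQ sFQ FX0; apply: contrapT => noX.
pose G := {X | F X /\ X0 `<=` X}.
have step (X : G) : exists Y : G, sval X `<=` sval Y /\ ~ sval Y `<=` sval X.
  case: X => X [FX sX]; apply: contrapT => noY; apply: noX; exists X => //.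
  move=> Y FY sXY; apply: contrapT => nYX; apply: noY.
  have GY : F Y /\ X0 `<=` Y by split=> // x /sX /sXY.
  by exists (exist _ Y GY).
have [f Hf] := choice step.
have G0 : F X0 /\ X0 `<=` X0 by split.
pose I n := iter n f (exist _ X0 G0).
have [|n /(_ n.+1 (leqnSn n)) EI] := accQ (fun n => sval (I n)) _ (fun n => (Hf _).1).
  by move=> n; apply: sFQ; case: (svalP (I n)).
by case: (Hf (I n)) => _; apply; rewrite -/(I n.+1) EI.
Qed.

Definition noetherian_module (R : nzRingType) (M : lmodType R) : Prop :=
  acc (@submodule R M).

Lemma left_idealP (R : nzRingType) (I : set R) : left_ideal I <->
  [/\ I 0, forall x y, I x -> I y -> I (x - y) & forall a x, I x -> I (a * x)].
Proof.
split=> [/submoduleP[I0 IB IM]|[I0 IB IM]].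
  by split=> // a x; apply: IM.
by apply/submoduleP; split=> // a x _; apply: IM.
Qed.

Lemma right_idealP (R : nzRingType) (I : set R) : right_ideal I <->
  [/\ I 0, forall x y, I x -> I y -> I (x - y) & forall a x, I x -> I (x * a)].
Proof. exact: (@left_idealP R^c). Qed.

(** Induction on the generators. The coefficients at [v] form an increasing chain of left ideals
    [L n]; once it is stationary, an element of a later [N p] can be corrected by an element of an
    earlier term with the same coefficient, which leaves a combination of the remaining
    generators. *)
Lemma fg_noetherian (R : nzRingType) (M : lmodType R) :
  left_noetherian R -> fg_module M -> noetherian_module M.
Proof.
move=> nR [m [g Hg]] N sN cN; have sT := subring_setT R.
have cN' := chain_sub cN.
have NS n := (submoduleP (N n)).1 (sN n).
suff main e : exists n, forall p, (n <= p)%N -> forall x : M,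
    span setT e x -> N p x -> N n x.
  have [n Hn] := main [seq g i | i <- enum 'I_m].
  exists n => p np; apply/seteqP; split; last exact: cN'.
  move=> x; apply: Hn => //; have [c ->] := Hg x.
  by apply/span_sumP => //; exists c.
elim: e => [|v e [n1 IHe]].
  by exists 0%N => p _ x /= -> _; case: (NS 0%N).
pose L n := [set a | exists2 s, span setT e s & N n (a *: v + s)].
have [E0 EB EZ] := span_stable e sT.
have LS n : left_ideal (L n).
  have [N0 NB NZ] := NS n; apply/left_idealP; split.
  - by exists 0; rewrite // scale0r addr0.
  - move=> a b [s es Ns] [t et Nt]; exists (s - t); first exact: EB.
    suff -> : (a - b) *: v + (s - t) = (a *: v + s) - (b *: v + t) by apply: NB.
    by rewrite scalerBl opprD addrACA.
  - move=> b a [s es Ns]; exists (b *: s); first exact: EZ.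
    by rewrite -scalerA -scalerDr; apply: NZ.
have [|n2 Hn2] := nR L LS.
  by move=> n a [s es Ns]; exists s => //; apply: cN.
exists (maxn n1 n2) => p; rewrite geq_max => /andP[n1p n2p] x [a _ es] Npx.
have : L p a by exists (x - a *: v); rewrite // addrC subrK.
rewrite (Hn2 p n2p) => -[t et Nt].
have [_ NB _] := NS (maxn n1 n2); have [_ NBp _] := NS p.
have {}Nt := cN' _ _ (leq_maxr n1 n2) _ Nt.
rewrite -[x](subrK (a *: v + t)).
apply: (stableD (NS _)) => //; apply: (cN') (leq_maxl n1 n2) _ _.
apply: (IHe p n1p).
  by rewrite opprD addrA; apply: EB.
apply: NBp => //; apply: (cN' (maxn n1 n2)) Nt => //.
by rewrite geq_max n1p.
Qed.

Section FiniteDimension.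
Variable k : fieldType.
Implicit Types V W : lmodType k.

Lemma fin_dimP V : fin_dim V <-> exists e : seq V, forall x, span setT e x.
Proof.
have sT := subring_setT k; split=> [[n [[f fL [g fK gK]]]]|[e He]].
  have gL c x y : g (c *: x + y) = c *: g x + g y.
    by apply: (can_inj fK); rewrite fL !gK.
  have g0 : g 0 = 0.
    by have := gL (-1) 0 0; rewrite scaler0 addr0 scaleN1r addNr.
  pose e := [seq g (delta_mx 0 i) | i <- enum 'I_n]; exists e => x.
  have sE := span_stable e sT; rewrite -[x]fK (row_sum_delta (f x)).
  elim/big_rec: _ => [|i y _ Hy]; first by rewrite g0; case: sE.
  rewrite gL; apply: (stableD sE) => //.
  have [_ _ EZ] := sE; apply: EZ => //; apply: mem_span => //.
  by apply/mapP; exists i; rewrite ?mem_enum.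
have [//|n [g [gS gI]]] := exists_basis sT _ He.
have /choice[f Hf] : forall x, exists c : 'I_n -> k, x = \sum_(i < n) c i *: g i.
  by move=> x; have [c _ Ex] := gS x; exists c.
have fU x (c : 'I_n -> k) : x = \sum_(i < n) c i *: g i -> f x = c.
  move=> Ex; apply/funext => i; apply/eqP; rewrite -subr_eq0; apply/eqP.
  apply: (gI (fun i => f x i - c i)) => //.
  under eq_bigr do rewrite scalerBl.
  by rewrite sumrB -Hf -Ex subrr.
exists n; apply: inhabits; exists (fun x => \row_i f x i).
  move=> a x y; apply/rowP => i; rewrite !mxE.
  rewrite (fU _ (fun i => a * f x i + f y i)) //.
  under eq_bigr do rewrite scalerDl -scalerA.
  by rewrite big_split -scaler_sumr -!Hf.
exists (fun v : 'rV_n => \sum_(i < n) v 0 i *: g i) => [x|v].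
  by rewrite [RHS]Hf; apply: eq_bigr => i _; rewrite mxE.
by apply/rowP => i; rewrite mxE (fU _ (v 0)).
Qed.

Lemma fin_codim_image V W (phi : V -> W) (N : set V) :
    (forall c x y, phi (c *: x + y) = c *: phi x + phi y) ->
    (forall x, N x -> phi x = 0) -> fin_codim N ->
  exists e : seq W, forall x, span setT e (phi x).
Proof.
move=> phiL phiN [e He]; have sT := subring_setT k.
have phi0 : phi 0 = 0.
  by have := phiL (-1) 0 0; rewrite scaler0 addr0 scaleN1r addNr.
exists (map phi e) => x.
have sE := span_stable (map phi e) sT; have [E0 EB EZ] := sE.
have [s es /phiN E] := He x; have -> : phi x = phi s.
  by move: E; rewrite addrC -scaleN1r phiL scaleN1r addrC => /eqP;
     rewrite subr_eq0 => /eqP.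
move: s es {x E}; apply: (@span_min _ _ _ _ [set s | span _ _ (phi s)]).
  split=> [|x z Hx Hz|c x _ Hx] /=; first by rewrite phi0.
    by rewrite addrC -scaleN1r phiL scaleN1r addrC; apply: EB.
  by rewrite -[c *: x]addr0 phiL phi0 addr0; apply: EZ.
by move=> v ve; apply: mem_span => //; apply: map_f.
Qed.

Lemma fin_dim_fin_codim V W (phi : V -> W) (N : set V) :
    (forall c x y, phi (c *: x + y) = c *: phi x + phi y) ->
    (forall y, exists x, phi x = y) -> (forall x, phi x = 0 <-> N x) ->
  fin_dim W <-> fin_codim N.
Proof.
move=> phiL phiS phiN; split=> [/fin_dimP[e He]|fN]; last first.
  have [x /phiN //|e He] := fin_codim_image phiL _ fN.
  by apply/fin_dimP; exists e => y; have [x <-] := phiS y.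
have sN : stable setT [set 0 : W].
  by split=> // [x y -> ->|c x _ ->]; rewrite ?subr0 ?scaler0.
have sV : stable setT [set: V] by [].
apply: fin_codimS (fin_codim_preimage (e := e) phiL sN sV (fin_codimT V) _).
  by move=> x [_ /phiN].
by move=> x _; exists (phi x) => //=; rewrite subrr.
Qed.

End FiniteDimension.

Lemma scaler_restrict (k : fieldType) (A : algType k) (M : lmodType A) c
    (a : A) (x : M) :
  (c *: a) *: x = c *: (a *: x : restrict_scalars M).
Proof. by rewrite -[a in LHS]mul1r scalerAl -scalerA. Qed.

Lemma scaler_restrictA (k : fieldType) (A : algType k) (M : lmodType A) c
    (a : A) (x : restrict_scalars M) :
  a *: (c *: x : M) = c *: (a *: (x : M) : restrict_scalars M).
Proof.
transitivity ((a * c%:A) *: (x : M)); first by rewrite -scalerA.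
by rewrite -scalerAr mulr1 scaler_restrict.
Qed.

(** * Finite-dimensionality of simple modules and of simple factor algebras *)

Lemma two_sided_idealP (R : nzRingType) (I : set R) : two_sided_ideal I <->
  [/\ I 0, forall x y, I x -> I y -> I (x - y), forall a x, I x -> I (a * x)
    & forall a x, I x -> I (x * a)].
Proof.
split=> [[/left_idealP[I0 IB Il] /right_idealP[_ _ Ir]] //|[I0 IB Il Ir]].
by split; [apply/left_idealP | apply/right_idealP].
Qed.

Section MaximalIdeals.
Variables (k : fieldType) (A : algType k).
Implicit Types (I J L : set A).

Lemma left_ideal_stable L : left_ideal L -> stable [set: k] L.
Proof.
move=> /left_idealP[L0 LB LM]; split=> // c x _ Lx.
by rewrite -[x]mul1r scalerAl; apply: LM.
Qed.

(** Elementwise maximality, [L + A a = A] for [a] outside [L]: it says that [A/L] is simple and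
    supplies the factor [b] used in computations. *)
Definition max_left_ideal L : Prop :=
  [/\ left_ideal L, ~ L 1 & forall a, ~ L a -> exists b, L (1 - b * a)].

Definition max_two_sided I : Prop :=
  [/\ two_sided_ideal I, ~ I 1
    & forall J, two_sided_ideal J -> I `<=` J -> J `<=` I \/ J 1].

Lemma quot_piB (I : proper_two_sided A) x y :
  \pi_(quot_alg I)%qT (x - y) =
  \pi_(quot_alg I)%qT x - \pi_(quot_alg I)%qT y.
Proof. by rewrite [RHS]piE. Qed.

Lemma quot_pi_eq0 (I : proper_two_sided A) x :
  \pi_(quot_alg I)%qT x = 0 <-> ideal_set I x.
Proof.
rewrite -[0](_ : \pi_(quot_alg I)%qT 0 = 0); last by rewrite piE.
by split=> [/quot_eqP/asboolP|Ix]; last (apply/quot_eqP/asboolP); rewrite subr0.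
Qed.

Lemma fin_dim_quot_alg (I : proper_two_sided A) :
  fin_dim (quot_alg I) <-> fin_codim (ideal_set I).
Proof.
apply: (@fin_dim_fin_codim _ _ _ (\pi_(quot_alg I)%qT)) => [c x y|y|x].
- by rewrite quot_piD -quot_scaleE.
- by exists (repr y); rewrite reprK.
exact: quot_pi_eq0.
Qed.

Lemma max_ideal_fin_dimP :
  (forall I : proper_two_sided A, maximal_ideal I -> fin_dim (quot_alg I)) <->
  (forall I, max_two_sided I -> fin_codim I).
Proof.
split=> [H I [I2 I1 Imax]|H I Imax].
  apply: (fin_dim_quot_alg (Defs.ProperIdeal I2 I1)).1; apply: H => J J2 sIJ /=.
  have [sJI|J1] := Imax J J2 sIJ; [left; exact/seteqP | right].
  apply/seteqP; split=> // x _; rewrite -[x]mulr1.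
  by have /two_sided_idealP[_ _ JM _] := J2; apply: JM.
apply/fin_dim_quot_alg/H; split; [exact: ideal_two_sided| exact: ideal_proper |].
by move=> J J2 sIJ; have [->|->] := Imax J J2 sIJ; [left | right].
Qed.

Lemma simple_module_gen (M : lmodType A) (x : M) :
  simple_module M -> x <> 0 -> forall y, exists a, y = a *: x.
Proof.
move=> [_ Msimple] x0 y.
have sN : submodule [set z | exists a, z = a *: x].
  apply/submoduleP; split=> [|_ _ [a ->] [b ->]|c _ _ [a ->]].
  - by exists 0; rewrite scale0r.
  - by exists (a - b); rewrite scalerBl.
  - by exists (c * a); rewrite scalerA.
have [E|E] := Msimple _ sN; last first.
  by have : [set: M] y by []; rewrite -E.
by case: x0; have : [set z | exists a, z = a *: x] x;
  [exists 1; rewrite scale1r | rewrite E].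
Qed.

(** Simple modules are, up to isomorphism, the quotients [A/L]: take for [L] the annihilator of a
    nonzero element, which generates the module. *)
Lemma simple_fin_dimP :
  (forall M : lmodType A, simple_module M -> fin_dim_module M) <->
  (forall L, max_left_ideal L -> fin_codim L).
Proof.
split=> [H L [Ll L1 Lmax]|H M Msimple].
  pose N := @Submod A A^o L Ll.
  have [] // := (@fin_dim_fin_codim k A (restrict_scalars (quot_mod N))
    (fun a => mod_pi N a) L _ _ _).
  - move=> c x y; rewrite -[x in LHS]mul1r scalerAl.
    exact: (@mod_pi_linear A A^o N).
  - exact: mod_pi_surj.
  - exact: (@mod_pi_eq0 A A^o N).
  move=> to_codim _; apply: to_codim; apply: H; split.
    by exists (mod_pi N (1 : A)) => /mod_pi_eq0.
  move=> S /submoduleP[S0 SB SZ].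
  have [sS|] := pselect (S `<=` [set 0]).
    by left; apply/seteqP; split=> // _ ->.
  move=> /existsNP[y /not_implyP[Sy y0]].
  have [a Ea] := mod_pi_surj y; subst y; right.
  have [|b Lb] := Lmax a; first by move=> La; apply: y0; apply/mod_pi_eq0.
  apply/seteqP; split=> // z _; have [c <-] := mod_pi_surj z.
  suff -> : mod_pi N c = (c * b) *: mod_pi N a by apply: SZ.
  apply/eqP; rewrite -subr_eq0 -linearZ -raddfB; apply/eqP/mod_pi_eq0 => /=.
  have /left_idealP[_ _ LM] := Ll.
  have := LM c _ Lb; rewrite mulrBr mulr1 mulrA.
  exact.
have [[x x0] _] := Msimple.
have gen := simple_module_gen Msimple x0.
apply/(@fin_dim_fin_codim k A (restrict_scalars M) (fun a => a *: x)
        [set a | a *: x = 0]) => [c a b|y|//|].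
- by rewrite scalerDl scaler_restrict.
- by have [a ->] := gen y; exists a.
apply: H; split=> [||a /= ax0].
- apply/left_idealP; split=> [|a b /= Ha Hb|a b /= Ha]; first by rewrite /= scale0r.
    by rewrite scalerBl Ha Hb subr0.
  by rewrite -scalerA Ha scaler0.
- by rewrite /= scale1r.
have [b Eb] := simple_module_gen Msimple ax0 x.
by exists b; rewrite scalerBl scale1r -scalerA -Eb subrr.
Qed.

End MaximalIdeals.

(** * Essential extensions of finite-dimensional modules *)

(* If P is the annihilator of every nonzero submodule of A/L, then L/P is not *)
(* essential in A/P.                                                          *)
Definition faithful_nonessential (R : nzRingType) : Prop :=
  forall P L : set R, two_sided_ideal P -> left_ideal L -> P `<=` L -> ~ L 1 ->
    (forall a b, ~ L a -> (forall c, L (b * c * a)) -> P b) ->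
    exists J, [/\ left_ideal J, ~ J `<=` P & J `&` L `<=` P].

Section EssentialExtension.
Variables (k : fieldType) (A : algType k) (U : lmodType A).
Hypothesis noethA : left_noetherian A.
Hypothesis faithfulA : faithful_nonessential A.
Hypothesis noethU : noetherian_module U.

Let fdsub (F : set U) :=
  exists e : seq (restrict_scalars U), F `<=` span setT e.

Lemma essential_fin_dim (F0 : set U) :
    submodule F0 -> fdsub F0 ->
    (forall v, v <> 0 -> exists2 a, a *: v <> 0 & F0 (a *: v)) ->
  fin_dim_module U.
Proof.
move=> F0s F0fd F0ess; have sT := subring_setT k.
have [|F [[Fs [e Fe]] sF0F] Fmax] :=
  @acc_max U (@submodule A U) [set N | submodule N /\ fdsub N] F0 noethU _
    (conj F0s F0fd); first by move=> N [].
have [FT|/existsNP[v1 Fv1]] := pselect (forall v, F v).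
  by apply/fin_dimP; exists e => x; apply: Fe.
have [F_0 FB FZ] := (submoduleP F).1 Fs.
(* The annihilator of [(A v + F)/F]; below, [v] is chosen outside [F] with this annihilator
   maximal. *)
pose annF v := [set a : A | forall b, F ((a * b) *: v)].
have [||_ [[v Fv ->] _] vmax] := @acc_max A (@left_ideal A)
    [set X | exists2 v, ~ F v & X = annF v] (annF v1) noethA.
  move=> _ [v Fv ->]; apply/left_idealP; split=> [b|a b Fa Fb c|c a Fa b].
  - by rewrite mul0r scale0r.
  - by rewrite mulrBl scalerBl; apply: FB.
  - by rewrite -mulrA -scalerA; apply: FZ.
  by exists v1.
pose P := annF v.
have Pmax a : ~ F (a *: v) -> annF (a *: v) `<=` P.
  move=> Fav; apply: vmax; first by exists (a *: v).
  by move=> x Px b; rewrite scalerA -mulrA; apply: Px.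
have P2 : two_sided_ideal P.
  apply/two_sided_idealP; split=> [b|a b Pa Pb c|c a Pa b|c a Pa b].
  - by rewrite mul0r scale0r.
  - by rewrite mulrBl scalerBl; apply: FB.
  - by rewrite -mulrA -scalerA; apply: FZ.
  - by rewrite -mulrA; apply: Pa.
(* [Y ps] collects the [x] that kill [K ps v]. With [ps] in [P] and [Y ps] maximal, adding an
   element of [P] to [ps] gains nothing, so [K ps] is the set of all [a] with [P a v = 0]. *)
pose K (ps : seq A) := [set a : A | forall p, p \in ps -> (p * a) *: v = 0].
pose Y (ps : seq A) := [set x : A | forall a, K ps a -> (x * a) *: v = 0].
have [||_ [[ps psP ->] _] psmax] := @acc_max A (@left_ideal A)
    [set X | exists2 ps : seq A, (forall p, p \in ps -> P p) & X = Y ps]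
    (Y [::]) noethA.
  move=> _ [ps psP ->]; apply/left_idealP; split=> [b _|a b Ya Yb c Kc|c a Ya b Kb].
  - by rewrite mul0r scale0r.
  - by rewrite mulrBl scalerBl (Ya c) ?(Yb c) ?subr0.
  - by rewrite -mulrA -scalerA Ya ?scaler0.
  by exists [::].
have KP a : K ps a -> forall x, P x -> (x * a) *: v = 0.
  move=> Ka x Px; apply: (psmax (Y (x :: ps))) (Ka) => [|y Yy b Kb|b].
  - by exists (x :: ps) => // p; rewrite inE => /predU1P[->|/psP].
  - by apply: Yy => p pps; apply: Kb; rewrite inE pps orbT.
  - by apply; rewrite mem_head.
(* Each map [a |-> p a v] takes values in the finite-dimensional [F], because [p] lies in [annF v];
   [K ps] is a finite intersection of kernels of such maps. *)
have fK : fin_codim (K ps).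
  apply: (@fin_codim_preimages k A A (restrict_scalars U)
    (fun p a => (p * a) *: v) [set 0] e ps) => [|p c x y|p x /psP Pp].
  - by split=> [//|x y -> ->|c x _ ->]; rewrite ?subrr ?scaler0.
  - by rewrite mulrDr scalerDl -scalerAr scaler_restrict.
  - by exists ((p * x) *: v); [apply: Fe; apply: Pp | rewrite /= subrr].
(* If [K ps] sent [v] into [F], then [A v + F] would be finite-dimensional, against the maximality
   of [F]. *)
have [[a Ka Fav]|noa] := pselect (exists2 a, K ps a & ~ F (a *: v)); last first.
  case: Fv; pose F1 := [set x | exists a, F (x - a *: v)].
  have [f Hf] := fK.
  suff /Fmax sF1 : submodule F1 /\ fdsub F1.
    apply: sF1 => [x Fx|]; first by exists 0; rewrite scale0r subr0.
    by exists 1; rewrite scale1r subrr.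
  split.
    apply/submoduleP; split=> [|x y [a Fx] [b Fy]|c x _ [a Fx]].
    - by exists 0; rewrite scale0r subr0.
    - by exists (a - b); rewrite scalerBl subrACA; apply: FB.
    - by exists (c * a); rewrite -scalerA -scalerBr; apply: FZ.
  pose g a : restrict_scalars U := a *: v.
  have gL (c : k) x y : g (c *: x + y) = c *: g x + g y.
    by rewrite /g scalerDl scaler_restrict.
  have g0 : g 0 = 0 by rewrite /g scale0r.
  exists (e ++ map g f) => x [a Fx].
  have sE := span_stable (e ++ map g f) sT.
  have [s fs Kas] := Hf a.
  have -> : x = (x - a *: v) + (g (a - s) + g s) :> restrict_scalars U.
    have <- : a *: v = g (a - s) + g s by rewrite -[a in LHS](subrK s) scalerDl.
    by apply/esym; apply: subrK.
  have inE' y : F y -> span [set: k] (e ++ map g f) (y : restrict_scalars U).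
    move=> /Fe; apply: sub_span => // u ue; apply: mem_span => //.
    by rewrite mem_cat ue.
  apply: (stableD sE); first exact: inE'.
  apply: (stableD sE).
    by apply: inE'; apply: contrapT => nF; apply: noa; exists (a - s).
  move: s fs {Kas}; apply: (@span_min _ _ _ _ [set s | span _ _ (g s)]).
    have [E0 EB EZ] := sE; split=> [|y z Hy Hz|c y _ Hy] /=.
    - by rewrite g0.
    - by rewrite addrC -scaleN1r gL scaleN1r addrC; apply: EB.
    - by rewrite -[c *: y]addr0 gL g0 addr0; apply: EZ.
  by move=> u uf; apply: mem_span => //; rewrite mem_cat map_f ?orbT.
set w := a *: v in Fav.
have Pw x : P x -> x *: w = 0 by move=> Px; rewrite scalerA KP.
pose L := [set x : A | F (x *: w)].
have Ll : left_ideal L.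
  apply/left_idealP; split=> [|x y Lx Ly|c x Lx]; rewrite /L /=.
  - by rewrite scale0r.
  - by rewrite scalerBl; apply: FB.
  - by rewrite -scalerA; apply: FZ.
have [] := faithfulA P2 Ll.
- by move=> x Px; rewrite /L /= Pw.
- by rewrite /L /= scale1r.
(* What kills [A b w] modulo [F] lies in [annF (b a v)], hence in [P] by the maximal choice of
   [v]. *)
- move=> b x Lb Lxb; apply: (Pmax (b * a)); first by rewrite -scalerA.
  by move=> c; have := Lxb c; rewrite /L /= /w !scalerA !mulrA.
move=> J [/left_idealP[_ _ JM] /existsNP[x /not_implyP[Jx Px]] JL].
(* [J w] meets [F] trivially, whereas the essential [F0], contained in [F], must meet [A x w]. *)
have [|b bxw Fb] := F0ess (x *: w).
  by move=> xw; apply: Px; apply: JL; split=> //; rewrite /L /= xw.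
case: bxw; rewrite scalerA; apply: Pw; apply: JL; split; first exact: JM.
by rewrite /L /= -scalerA; apply: sF0F.
Qed.

End EssentialExtension.

(** * The equivalences *)

Section Implications.
Variables (k : fieldType) (A : algType k).
Implicit Types (I J L P : set A).

Lemma fg_quot_mod (M : lmodType A) (N : submod M) :
  fg_module M -> fg_module (quot_mod N).
Proof.
move=> [n [g Hg]]; exists n, (fun i => mod_pi N (g i)) => y.
have [x <-] := mod_pi_surj y; have [c ->] := Hg x; exists c.
rewrite raddf_sum; apply: eq_bigr => i _.
exact: mod_piZ.
Qed.

(** For [x] nonzero, let [N] be maximal among the submodules avoiding [x]. In [M/N] the image of [x]
    lies in every nonzero submodule, so it generates an essential simple submodule,
    finite-dimensional by hypothesis; [essential_fin_dim] then makes [M/N] a finite-dimensional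
    quotient detecting [x]. *)
Lemma left_fully_rfd :
    left_noetherian A -> faithful_nonessential A ->
    (forall L, max_left_ideal L -> fin_codim L) ->
  left_fully_residually_fin_dim A.
Proof.
move=> noethA faithA simpleA M fgM.
exists {N : submod M | fin_dim_module (quot_mod N)}.
exists (fun t => quot_mod (sval t)), (fun t => mod_pi (sval t)).
split=> [[N fdN]|[N fdN]|x Hx] /=; [exact: fdN | exact: mod_pi_surj|].
apply: contrapT => x0.
have [||N [[Ns Nx] _] Nmax] := @acc_max M (@submodule A M)
    [set N | submodule N /\ ~ N x] [set 0] (fg_noetherian noethA fgM).
- by move=> N [].
- split=> //; apply/submoduleP.
  by split=> // [y z -> ->|c y _ ->]; rewrite ?subr0 ?scaler0.
pose N' := Submod Ns; apply: (Nx); apply/(@mod_pi_eq0 _ _ N').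
suff fdN : fin_dim_module (quot_mod N') by apply: (Hx (exist _ N' fdN)).
have [N0 NB NZ] := (submoduleP N).1 Ns.
have Nmax' v : ~ N v -> exists a, N (x - a *: v).
  move=> Nv; apply: contrapT => Nxv; apply: Nv.
  apply: (Nmax [set y | exists a, N (y - a *: v)]) => [|y Ny|].
  - split=> //; apply/submoduleP; split=> [|y z [a Ha] [b Hb]|c y _ [a Ha]].
    + by exists 0; rewrite scale0r subr0.
    + by exists (a - b); rewrite scalerBl subrACA; apply: NB.
    + by exists (c * a); rewrite -scalerA -scalerBr; apply: NZ.
  - by exists 0; rewrite scale0r subr0.
  - by exists 1; rewrite scale1r subrr.
pose F0 := [set y : quot_mod N' | exists a, y = a *: mod_pi N' x].
apply: (@essential_fin_dim k A _ noethA faithA _ F0).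
- exact/fg_noetherian/fg_quot_mod.
- apply/submoduleP; split=> [|_ _ [a ->] [b ->]|c _ _ [a ->]].
  + by exists 0; rewrite scale0r.
  + by exists (a - b); rewrite scalerBl.
  + by exists (c * a); rewrite scalerA.
- have [] := @fin_codim_image k A (restrict_scalars (quot_mod N'))
    (fun a => a *: mod_pi N' x) [set a | N (a *: x)].
  + by move=> c a b; rewrite scalerDl scaler_restrict.
  + by move=> a Na; rewrite -mod_piZ; apply/mod_pi_eq0.
  + apply: simpleA; split=> [|/=|a /= Nax]; last 1 first.
    * have [b Hb] := Nmax' _ Nax; exists b.
      by rewrite scalerBl scale1r -scalerA.
    * apply/left_idealP; split=> [|a b Ha Hb|c a Ha] /=.
      - by rewrite scale0r.
      - by rewrite scalerBl; apply: NB.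
      - by rewrite -scalerA; apply: NZ.
    * by rewrite scale1r.
  by move=> e He; exists e => _ [a ->].
move=> y y0; have [v Ev] := mod_pi_surj y; subst y.
have [|a Na] := Nmax' v; first by move=> Nv; apply: y0; apply/mod_pi_eq0.
have Ea : a *: mod_pi N' v = mod_pi N' x.
  by apply/eqP; rewrite eq_sym -subr_eq0 -mod_piZ -raddfB; apply/eqP/mod_pi_eq0.
exists a; last by exists 1; rewrite scale1r.
by rewrite Ea => /mod_pi_eq0.
Qed.


Section QuotQuot.
Variables (I Q : proper_two_sided A).
Hypothesis sIQ : ideal_set I `<=` ideal_set Q.

(** The inclusion is an argument so that the morphism structures below, which rest on it, attach to
    the function. *)
Definition quot_quot of ideal_set I `<=` ideal_set Q :
  quot_alg I -> quot_alg Q := fun x => \pi_(quot_alg Q)%qT (repr x).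

Lemma quot_quotE x :
  quot_quot sIQ (\pi_(quot_alg I)%qT x) = \pi_(quot_alg Q)%qT x.
Proof.
apply/quot_eqP/asboolP/sIQ/asboolP/quot_eqP.
by rewrite reprK.
Qed.

Lemma quot_quot_linear : linear (quot_quot sIQ).
Proof.
move=> c x y; rewrite -[x]reprK -[y]reprK.
have -> : c *: \pi_(quot_alg I)%qT (repr x) + \pi_(quot_alg I)%qT (repr y) =
    \pi_(quot_alg I)%qT (c *: repr x + repr y) by rewrite quot_piD -quot_scaleE.
by rewrite !quot_quotE quot_piD -quot_scaleE.
Qed.

Lemma quot_quot_monoid_morphism : monoid_morphism (quot_quot sIQ).
Proof.
split=> [|x y]; first exact: quot_quotE.
rewrite -[x]reprK -[y]reprK.
have -> : \pi_(quot_alg I)%qT (repr x) * \pi_(quot_alg I)%qT (repr y) =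
    \pi_(quot_alg I)%qT (repr x * repr y) by rewrite -quot_mulE.
by rewrite !quot_quotE -quot_mulE.
Qed.

HB.instance Definition _ := GRing.isLinear.Build k (quot_alg I) (quot_alg Q)
  *:%R (quot_quot sIQ) quot_quot_linear.
HB.instance Definition _ := GRing.isMonoidMorphism.Build
  (quot_alg I) (quot_alg Q) (quot_quot sIQ) quot_quot_monoid_morphism.

End QuotQuot.

Lemma rfd_quot_alg (I : proper_two_sided A) :
    (forall x, ~ ideal_set I x -> exists Q, [/\ two_sided_ideal Q,
       ideal_set I `<=` Q, ~ Q x, ~ Q 1 & fin_codim Q]) ->
  residually_fin_dim (quot_alg I).
Proof.
move=> H.
pose T := {Q : proper_two_sided A | ideal_set I `<=` ideal_set Q
                                    /\ fin_codim (ideal_set Q)}.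
pose f (t : T) : {lrmorphism quot_alg I -> quot_alg (sval t)} :=
  quot_quot (svalP t).1.
exists T, (fun t => quot_alg (sval t)), f; split=> [[Q [sIQ fQ]]|t y|x Hx] /=.
- exact/fin_dim_quot_alg.
- exists (\pi_(quot_alg I)%qT (repr y)).
  by rewrite /f /= (quot_quotE (svalP t).1) reprK.
apply: contrapT => x0; rewrite -[x]reprK in Hx x0.
have [|Q [Q2 sIQ Qx Q1 fQ]] := H (repr x).
  by move=> Ix; apply: x0; apply/quot_pi_eq0.
have tQ : ideal_set I `<=` ideal_set (Defs.ProperIdeal Q2 Q1) /\
    fin_codim (ideal_set (Defs.ProperIdeal Q2 Q1)) by [].
have := Hx (exist _ (Defs.ProperIdeal Q2 Q1) tQ).
by rewrite /f /= quot_quotE => /quot_pi_eq0.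
Qed.

Lemma left_fully_strongly_rfd :
  left_fully_residually_fin_dim A -> strongly_residually_fin_dim A.
Proof.
move=> rfdA I; have [Il Ir] := ideal_two_sided I.
pose N := @Submod A A^o (ideal_set I) Il.
have [|T [M [f [fdM _ fI]]]] := rfdA (quot_mod N).
  exists 1%N, (fun=> mod_pi N (1 : A)) => y; have [a <-] := mod_pi_surj y.
  exists (fun=> a); rewrite big_ord_recl big_ord0 addr0 -mod_piZ.
  by congr mod_pi; apply/esym/mulr1.
apply: rfd_quot_alg => x Ix.
have [t ftx] : exists t, f t (mod_pi N (x : A)) <> 0.
  apply/existsNP => fx; apply: Ix; apply/(mod_pi_eq0 N); exact: fI.
have [I0 IB _ IM] := (two_sided_idealP _).1 (ideal_two_sided I).
(* The annihilator of the image of [f t]: it contains [I] because [I] is a right ideal, and taking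
   [b = 1] shows that it misses [x]. *)
pose Q := [set a : A | forall b, f t (mod_pi N (a * b : A)) = 0].
have fZ a b : f t (mod_pi N (a * b : A)) = a *: f t (mod_pi N (b : A)).
  by rewrite -linearZ -mod_piZ.
exists Q; split.
- apply/two_sided_idealP; split=> [b|a b Qa Qb c|c a Qa b|c a Qa b].
  + by rewrite mul0r raddf0 raddf0.
  + by rewrite mulrBl raddfB raddfB /= Qa Qb subr0.
  + by rewrite -mulrA fZ Qa scaler0.
  + by rewrite -mulrA Qa.
- move=> a Ia b; rewrite (mod_pi_eq0 N _).2 ?raddf0 //; exact: IM.
- by move/(_ 1); rewrite mulr1.
- by move/(_ x); rewrite mul1r.
have /fin_dimP[e He] := fdM t.
apply: (@fin_codimS k A [set a : A | forall y, y \in e -> a *: (y : M t) = 0]).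
  move=> a Ha b; rewrite fZ.
  apply: (@span_min k (restrict_scalars (M t)) setT e
    [set y : restrict_scalars (M t) | a *: (y : M t) = 0]) (He _).
    split=> [|y z Hy Hz|c y _ Hy] /=; first by rewrite scaler0.
      by rewrite scalerBr Hy Hz subr0.
    by rewrite scaler_restrictA Hy scaler0.
  exact: Ha.
apply: (@fin_codim_preimages k _ A (restrict_scalars (M t))
  (fun y a => a *: (y : M t)) [set 0] e) => [|y c a b|y a _].
- by split=> [//|y z -> ->|c y _ ->]; rewrite ?subrr ?scaler0.
- by rewrite scalerDl scaler_restrict.
- by exists (a *: (y : M t)); [apply: He | rewrite /= subrr].
Qed.

Lemma strongly_rfd_max_two_sided I :
  strongly_residually_fin_dim A -> max_two_sided I -> fin_codim I.
Proof.
move=> rfdA [I2 I1 Imax].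
have [T [B [f [fdB fS fI]]]] := rfdA (Defs.ProperIdeal I2 I1).
have [t _] : exists t, f t 1 <> 0.
  by apply/existsNP => /fI /eqP; rewrite oner_eq0.
set pi := \pi_(quot_alg (Defs.ProperIdeal I2 I1))%qT.
have piD x y : pi (x + y) = pi x + pi y by exact: quot_piD.
have piM x y : pi (x * y) = pi x * pi y by rewrite [RHS]quot_mulE.
have piZ c x : pi (c *: x) = c *: pi x by rewrite [RHS]quot_scaleE.
have pi0 : pi 0 = 0 by apply/quot_pi_eq0; have /two_sided_idealP[] := I2.
pose Q := [set a : A | f t (pi a) = 0].
have QZ c x y : f t (pi (c *: x + y)) = c *: f t (pi x) + f t (pi y).
  by rewrite piD piZ raddfD /= linearZ.
have Q2 : two_sided_ideal Q.
  apply/two_sided_idealP; rewrite /Q; split=> [|a b /= Qa Qb|c a /= Qa|c a /= Qa].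
  - by rewrite /= pi0 raddf0.
  - by rewrite addrC -scaleN1r QZ Qa Qb scaler0 addr0.
  - by rewrite piM rmorphM /= Qa mulr0.
  - by rewrite piM rmorphM /= Qa mul0r.
have [x Ix|sQI|Q1] := Imax Q Q2.
- rewrite /Q /=; suff -> : pi x = 0 by rewrite raddf0.
  exact/quot_pi_eq0.
- apply: fin_codimS sQI _; apply: ((fin_dim_fin_codim QZ _ _).1 (fdB t)) => //.
  move=> y; have [x <-] := fS t y; exists (repr x).
  by rewrite /pi reprK.
by have /eqP := Q1; rewrite rmorph1 oner_eq0.
Qed.

Lemma max_left_ideal_above I : left_noetherian A -> left_ideal I -> ~ I 1 ->
  exists2 L, max_left_ideal L & I `<=` L.
Proof.
move=> noethA Il I1.
have [||L [[Ll L1] sIL] Lmax] := @acc_max A (@left_ideal A)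
  [set L | left_ideal L /\ ~ L 1] I noethA; [by move=> L [] | by [] |].
exists L => //; split=> // a La; apply: contrapT => nob; apply: La.
have [L0 LB LM] := (left_idealP L).1 Ll.
apply: (Lmax [set x | exists b, L (x - b * a)]) => [|x Lx|].
- split; last by [].
  apply/left_idealP; split=> [|x y [b Hb] [c Hc]|d x [b Hb]].
  + by exists 0; rewrite mul0r subr0.
  + by exists (b - c); rewrite mulrBl subrACA; apply: LB.
  + by exists (d * b); rewrite -mulrA -mulrBr; apply: LM.
- by exists 0; rewrite mul0r subr0.
- by exists 1; rewrite mul1r subrr.
Qed.

Lemma max_left_max_two_sided I : left_noetherian A ->
  (forall L, max_left_ideal L -> fin_codim L) -> max_two_sided I -> fin_codim I.
Proof.
move=> noethA fcL [I2 I1 Imax]; have [Il _] := I2.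
have [L Lmax sIL] := max_left_ideal_above noethA Il I1.
have [Ll L1 _] := Lmax; have sL := left_ideal_stable Ll.
have [L0 LB LM] := (left_idealP L).1 Ll.
have [I0 IB IMl IMr] := (two_sided_idealP I).1 I2.
(* The annihilator of [A/L], a proper two-sided ideal above [I] and therefore inside it. *)
pose J := [set a | forall b, L (a * b)].
have sJI : J `<=` I.
  have [|a Ia b|//|J1] := Imax J.
  - apply/two_sided_idealP; split=> [b|a b Ja Jb c|c a Ja b|c a Ja b].
    + by rewrite mul0r.
    + by rewrite mulrBl; apply: LB.
    + by rewrite -mulrA; apply: LM.
    + by rewrite -mulrA.
  - by apply: sIL; apply: IMr.
  - by case: L1; rewrite -[1]mulr1.
have [e He] := fcL L Lmax; apply: fin_codimS sJI _.
apply: (@fin_codimS k A [set a | forall y, y \in e -> L (a * y)]).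
  move=> a Ha b; have [s es Lbs] := He b.
  rewrite -[b](subrK s) mulrDr; apply: (stableD sL); first exact: LM.
  apply: (@span_min k A setT e [set s | L (a * s)]) es; last exact: Ha.
  split=> [|x y Hx Hy|c x _ Hx] /=; first by rewrite mulr0.
    by rewrite mulrBr; apply: LB.
  by rewrite -scalerAr; have [_ _ LZ] := sL; apply: LZ.
apply: (@fin_codim_preimages k A A A (fun y a => a * y) L e) => //.
  by move=> y c a b; rewrite mulrDl scalerAl.
Qed.

(* With J as in faithful_nonessential, J/P is a simple submodule of A/P, and  *)
(* A/P embeds in a finite power of it because finitely many elements ss of J  *)
(* suffice to detect P; hence P is maximal.                                   *)
Lemma max_two_sided_max_left L :
    faithful_nonessential A -> acc (@right_ideal A) ->
    (forall I, max_two_sided I -> fin_codim I) ->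
  max_left_ideal L -> fin_codim L.
Proof.
move=> faithA accA fcI [Ll L1 Lmax].
have [L0 LB LM] := (left_idealP L).1 Ll.
pose P := [set b | forall c, L (b * c)].
have P2 : two_sided_ideal P.
  apply/two_sided_idealP; split=> [b|a b Pa Pb c|c a Pa b|c a Pa b].
  - by rewrite mul0r.
  - by rewrite mulrBl; apply: LB.
  - by rewrite -mulrA; apply: LM.
  - by rewrite -mulrA.
have [P0 PB PMl PMr] := (two_sided_idealP P).1 P2.
have sPL : P `<=` L by move=> b Pb; rewrite -[b]mulr1; apply: Pb.
have PL a b : ~ L a -> (forall c, L (b * c * a)) -> P b.
  move=> /Lmax[e Le] H d; rewrite -[d](subrK (d * e * a)) mulrDr.
  apply: (stableD (left_ideal_stable Ll)); last by rewrite !mulrA -(mulrA b).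
  by rewrite -[d in d - _]mulr1 -mulrA -mulrBr mulrA; apply: LM.
have prime r j : (forall c, P (r * c * j)) -> ~ P j -> P r.
  move=> H /existsNP[b Ljb]; apply: (PL (j * b)) => // c.
  by rewrite mulrA; apply: H.
have [//|J [Jl /existsNP[j0 /not_implyP[Jj0 Pj0]] JL]] := faithA P L P2 Ll sPL L1.
have [J0 JB JM] := (left_idealP J).1 Jl.
(* For [ss] in [J] with [X ss] maximal, [X ss] absorbs every element of [J]. So [r ss] inside [P]
   forces [r J] inside [P], and then [r] is in [P] by primeness. *)
pose X (ss : seq A) :=
  [set x | forall r, (forall s, s \in ss -> P (r * s)) -> P (r * x)].
have [||_ [[ss ssJ ->] _] ssmax] := @acc_max A (@right_ideal A)
    [set Y | exists2 ss : seq A, (forall s, s \in ss -> J s) & Y = X ss] (X [::]) accA.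
- move=> _ [ss _ ->]; apply/right_idealP.
  split=> [r _|x y Xx Xy r Hr|c x Xx r Hr].
  + by rewrite mulr0.
  + by rewrite mulrBr; apply: PB; [apply: Xx | apply: Xy].
  + by rewrite mulrA; apply: PMr; apply: Xx.
- by exists [::].
have ssP r : (forall s, s \in ss -> P (r * s)) -> P r.
  move=> Hr; apply: (prime _ j0) => // c; rewrite -mulrA.
  have Jj : J (c * j0) by apply: JM.
  apply: (ssmax (X ((c * j0) :: ss))) (Hr) => [|y Xy q Hq|q Hq].
  - by exists (c * j0 :: ss) => // s; rewrite inE => /predU1P[->|/ssJ].
  - by apply: Xy => s sss; apply: Hq; rewrite inE sss orbT.
  - by apply: Hq; rewrite mem_head.
suff : fin_codim P by exact: fin_codimS.
apply: fcI; split=> //; first by move=> P1; apply: L1; apply: sPL.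
move=> I I2 sPI; have [|/existsNP[i0 /not_implyP[Ii0 Pi0]]] := pselect (I `<=` P).
  by left.
right; have [I0 IB IMl IMr] := (two_sided_idealP I).1 I2.
have : [set r | forall s, s \in ss -> P (r * s)] `<=` I by move=> r /ssP /sPI.
(* The conditions at the elements of [ss] are dropped one at a time; once none is left, [I] contains
   everything. *)
elim: (ss) ssJ => [|s ts IHss] ssJ sub; first exact: sub.
apply: IHss => [t tts|r Hr]; first by apply: ssJ; rewrite inE tts orbT.
have [Prs|Prs] := pselect (P (r * s)).
  by apply: sub => t; rewrite inE => /predU1P[->|/Hr].
have [c Pc] : exists c, ~ P (i0 * c * (r * s)).
  by apply/existsNP => H; apply: Pi0; apply: prime H Prs.
pose t := i0 * c * r.
have Js : J s by apply: ssJ; rewrite mem_head.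
have Lts : ~ L (t * s).
  by move=> Lts; apply: Pc; rewrite mulrA; apply: JL; split=> //; apply: JM.
have [b Lb] := Lmax _ Lts.
(* Modulo [P], [r s] equals [r s b t s], as the difference lies in both [J] and [L]. So
   [r - r s b t] meets the condition at [s] as well, while [r s b t] is in [I] through the factor
   [i0] of [t]. *)
rewrite -[r](subrK (r * s * b * t)); apply: (stableD (left_ideal_stable I2.1)).
  apply: sub => u; rewrite inE => /predU1P[->|uts]; rewrite mulrBl.
    apply: JL; split; first by apply: JB; apply: JM.
    have -> : r * s - r * s * b * t * s = r * s * (1 - b * (t * s)).
      by rewrite mulrBr mulr1 !mulrA.
    exact: LM.
  apply: PB; first exact: Hr.
  by rewrite /t -!mulrA; do 5!apply: (PMl); apply: Hr.
by apply: IMl; rewrite /t -mulrA; apply: IMr.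
Qed.

End Implications.

(** * Fully bounded rings *)

Lemma converse_two_sided (R : nzRingType) (I : set R) :
  @two_sided_ideal R^c I <-> two_sided_ideal I.
Proof.
split=> /two_sided_idealP[I0 IB Il Ir].
  by apply/two_sided_idealP; split.
by apply/(@two_sided_idealP R^c); split.
Qed.

Lemma converse_prime_ring (R : nzRingType) : prime_ring R^c -> prime_ring R.
Proof.
move=> primeR I J I2 J2 IJ0.
have [] := primeR J I _ _ _; [exact/converse_two_sided.. | | by right | by left].
by move=> x y Jx Iy; apply: IJ0.
Qed.

(** The factor ring is an abstract image [B] with kernel [P], so as to serve both [A/P] and its
    converse. Primeness follows from the hypothesis on annihilators. If the image of [L] were
    essential, it would contain a nonzero two-sided ideal; an [x] outside [P] lifting an element of
    that ideal satisfies [x R] inside [L], so it annihilates [R/L] and is in [P]. *)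
Lemma bounded_faithful_nonessential (R : nzRingType) :
    (forall P : set R, two_sided_ideal P -> ~ P 1 ->
       exists (B : nzRingType) (pi : R -> B),
       [/\ (forall x y, pi (x - y) = pi x - pi y)
          /\ (forall x y, pi (x * y) = pi x * pi y),
           forall y, exists x, pi x = y, forall x, pi x = 0 <-> P x
         & prime_ring B -> left_bounded B]) ->
  faithful_nonessential R.
Proof.
move=> bd P L P2 Ll sPL L1 PL.
have P1 : ~ P 1 by move=> /sPL.
have [B [pi [[piB piM] piS piK] bdB]] := bd P P2 P1.
have [P0 PB PMl PMr] := (two_sided_idealP P).1 P2.
have [L0 LB LM] := (left_idealP L).1 Ll.
have pi0 : pi 0 = 0 by apply/piK.
have neq0 (J : set B) : left_ideal J -> J <> [set 0] ->
    exists2 x, J (pi x) & ~ P x.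
  move=> /left_idealP[J0 _ _] J_neq0; apply: contrapT => H; apply: J_neq0.
  apply/seteqP; split=> [y|_ -> //]; have [x <-] := piS y => Jx.
  by apply/piK; apply: contrapT => Px; apply: H; exists x.
have prime r j : (forall c, P (r * c * j)) -> ~ P j -> P r.
  move=> H Pj; have [c Lc] : exists c, ~ L (j * c * 1).
    by apply/existsNP => Lj; apply: Pj; apply: PL Lj.
  by apply: (PL _ _ Lc) => d; apply: sPL; rewrite mulr1 mulrA; apply: PMr.
have primeB : prime_ring B.
  move=> I J I2 J2 IJ0; apply: contrapT => /not_orP[I0 J0].
  have [x Ix Px] := neq0 _ I2.1 I0; have [y Jy Py] := neq0 _ J2.1 J0.
  have /two_sided_idealP[_ _ _ IMr] := I2.
  apply: Px; apply: (prime _ y) => // c; apply/piK; rewrite !piM.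
  by apply: IJ0 => //; apply: IMr.
apply: contrapT => noJ; pose E := [set pi x | x in L].
have essE : essential_left_ideal E.
  split.
    apply/left_idealP; split; first by exists 0.
      by move=> _ _ [x Lx <-] [y Ly <-]; exists (x - y); [apply: LB | rewrite piB].
    move=> a _ [x Lx <-]; have [b <-] := piS a.
    by exists (b * x); [apply: LM | rewrite piM].
  move=> J Jl J0 EJ; have [x Jx Px] := neq0 J Jl J0.
  have [J_0 JB JM] := (left_idealP J).1 Jl.
  apply: noJ; exists [set x | J (pi x)]; split.
  - apply/left_idealP; split=> [|u v /= Ju Jv|a u /= Ju]; first by rewrite /= pi0.
      by rewrite piB; apply: JB.
    by rewrite piM; apply: JM.
  - by move=> sJP; apply: Px; apply: sJP.
  move=> u [Ju Lu]; apply/piK; have : (E `&` J) (pi u) by split=> //; exists u.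
  by rewrite EJ.
have [I [I2 I0 sIE]] := bdB primeB E essE.
have [x Ix Px] := neq0 I I2.1 I0.
have /two_sided_idealP[_ _ _ IMr] := I2.
apply: Px; apply: (PL 1) => // c; rewrite mulr1.
have /sIE[y Ly] : I (pi (x * c)) by rewrite piM; apply: IMr.
move=> /eqP; rewrite -subr_eq0 -piB => /eqP/piK/sPL Lyx.
by have := LB _ _ Ly Lyx; rewrite opprB addrCA subrr addr0.
Qed.

Section FullyBounded.
Variables (k : fieldType) (A : algType k).
Hypothesis fbnA : fully_bounded_noetherian A.

Lemma fbn_faithful_nonessential : faithful_nonessential A.
Proof.
apply: bounded_faithful_nonessential => P P2 P1.
pose I := Defs.ProperIdeal P2 P1; exists (quot_alg I), (\pi_(quot_alg I)%qT).
split; last by move=> /(fbnA.2 I)[].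
- split=> x y; last by rewrite -quot_mulE.
  exact: quot_piB.
- by move=> y; exists (repr y); rewrite reprK.
- exact: quot_pi_eq0.
Qed.

Lemma fbn_faithful_nonessential_converse : faithful_nonessential A^c.
Proof.
apply: bounded_faithful_nonessential => P /converse_two_sided P2 P1.
pose I := Defs.ProperIdeal P2 P1.
exists (quot_alg I)^c, (\pi_(quot_alg I)%qT : A^c -> (quot_alg I)^c).
split; last by move=> /converse_prime_ring/(fbnA.2 I)[].
- split=> x y; last by rewrite [RHS]quot_mulE.
  exact: quot_piB.
- by move=> y; exists (repr y); rewrite reprK.
- exact: (quot_pi_eq0 I).
Qed.

End FullyBounded.

Section Converse.
Variables (k : fieldType) (A : algType k).

Lemma converse_max_two_sided (I : set A) :
  @max_two_sided k A^c I <-> max_two_sided I.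
Proof.
split=> -[I2 I1 Imax]; split=> //; first exact/converse_two_sided.
- by move=> J /converse_two_sided J2 sIJ; apply: Imax.
- exact/converse_two_sided.
- by move=> J /converse_two_sided J2 sIJ; apply: Imax.
Qed.

Lemma converse_max_fin_codim :
  (forall I : set A^c, max_two_sided I -> fin_codim I) <->
  (forall I : set A, max_two_sided I -> fin_codim I).
Proof. by split=> H I /converse_max_two_sided; apply: H. Qed.

Lemma left_noetherian_acc_converse :
  left_noetherian A -> acc (@right_ideal A^c).
Proof.
move=> noethA I HI; apply: noethA => n.
by have /right_idealP[I0 IB IM] := HI n; apply/left_idealP; split.
Qed.

End Converse.

Lemma fbn_equivalences (k : fieldType) (A : algType k) :
  fully_bounded_noetherian A ->
  [<-> fully_residually_fin_dim A;
       strongly_residually_fin_dim A;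
       (forall M : lmodType A, simple_module M -> fin_dim_module M);
       (forall M : lmodType A^c, simple_module M -> fin_dim_module M);
       (forall I : proper_two_sided A, maximal_ideal I -> fin_dim (quot_alg I))].
Proof.
move=> fbnA; have [[noethA noethAc] _] := fbnA.
have faithA := fbn_faithful_nonessential fbnA.
have faithAc := fbn_faithful_nonessential_converse fbnA.
have maxL (d : forall I : set A, max_two_sided I -> fin_codim I) L :
  max_left_ideal L -> fin_codim L := max_two_sided_max_left faithA noethAc d.
have maxR (d : forall I : set A, max_two_sided I -> fin_codim I) (L : set A^c) :
    max_left_ideal L -> fin_codim L.
  apply: max_two_sided_max_left; first exact: faithAc.
    exact: left_noetherian_acc_converse noethA.
  exact: (@converse_max_fin_codim k A).2 d.
tfae.
- by case=> rfdA _; apply: left_fully_strongly_rfd.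
- move=> rfdA; apply/simple_fin_dimP; apply: maxL => I.
  exact: strongly_rfd_max_two_sided.
- move=> /simple_fin_dimP c; apply/simple_fin_dimP; apply: maxR => I.
  exact: max_left_max_two_sided.
- move=> /simple_fin_dimP c; apply/max_ideal_fin_dimP/converse_max_fin_codim => I.
  exact: max_left_max_two_sided.
- move=> /max_ideal_fin_dimP d; split; apply: left_fully_rfd => //.
    exact: maxL.
  exact: maxR.
Qed.

(** * Multilinear identities *)

Section MultilinearPolynomials.
Variables (k : fieldType) (d : nat).
Implicit Types (c : seq 'I_d -> k) (w : seq 'I_d).

(* The sum of c w * x_w over the words w of length m. *)
Fixpoint pol (A : algType k) m c (x : 'I_d -> A) : A :=
  if m is m'.+1 then \sum_(j < d) pol m' (fun w => c (rcons w j)) x * x j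
  else (c [::])%:A.

(** The same polynomial with operators for variables, the last letter acting first. Operators are
    bare functions; additivity is assumed where it is used. *)
Fixpoint opol (V : lmodType k) m c (x : 'I_d -> V -> V) (v : V) : V :=
  if m is m'.+1 then \sum_(j < d) opol m' (fun w => c (rcons w j)) x (x j v)
  else c [::] *: v.

Definition multilinear c : Prop :=
  (exists2 w, size w = d & c w != 0) /\
  (forall w, size w = d -> c w != 0 -> uniq w).

Lemma opol_scale (A : algType k) (M : lmodType A) m c (x : 'I_d -> A) (v : M) :
  @opol (restrict_scalars M) m c (fun i u => x i *: (u : M)) v = pol m c x *: v.
Proof.
elim: m c v => [//|m IHm] c v /=.
by rewrite scaler_suml; apply: eq_bigr => j _; rewrite IHm scalerA.
Qed.

(** Recursion on the first letter instead of the last, as needed to reverse words in the converse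
    algebra. *)
Lemma pol_recl (A : algType k) m c (x : 'I_d -> A) :
  pol m.+1 c x = \sum_(j < d) x j * pol m (fun w => c (j :: w)) x.
Proof.
elim: m c => [|m IHm] c.
  by apply: eq_bigr => j _; rewrite /= -scalerAl -scalerAr mul1r mulr1.
have -> : pol m.+2 c x = \sum_(i < d) \sum_(j < d)
    x j * pol m (fun w => c (rcons (j :: w) i)) x * x i.
  have -> : pol m.+2 c x =
    \sum_(i < d) pol m.+1 (fun w => c (rcons w i)) x * x i by [].
  by apply: eq_bigr => i _; rewrite IHm mulr_suml.
rewrite exchange_big; apply: eq_bigr => j _ /=; rewrite mulr_sumr.
by apply: eq_bigr => i _; rewrite mulrA.
Qed.

Lemma pol_converse (A : algType k) m c (x : 'I_d -> A) :
  @pol A^c m c x = pol m (c \o rev) x.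
Proof.
elim: m c => [//|m IHm] c; rewrite [RHS]pol_recl /=; apply: eq_bigr => j _.
have E : (fun w => c (rcons w j)) \o rev = fun w => c (rev (j :: w)).
  by apply/funext => w /=; rewrite rev_cons.
by rewrite IHm E.
Qed.

Section Operators.
Variable V : lmodType k.
Implicit Types (x y : 'I_d -> V -> V).

Lemma opol0 m c x v : (forall w, size w = m -> c w = 0) -> opol m c x v = 0.
Proof.
elim: m c v => [|m IHm] c v c0 /=; first by rewrite c0 ?scale0r.
by rewrite big1 // => j _; apply: IHm => w Ew; rewrite c0 // size_rcons Ew.
Qed.

Lemma opol_indep m c x y j v :
    (forall w, size w = m -> j \in w -> c w = 0) ->
    (forall i, i != j -> x i = y i) -> opol m c x v = opol m c y v.
Proof.
move=> + xy; elim: m c v => [//|m IHm] c v c0 /=; apply: eq_bigr => i _.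
have [->|/xy ->] := eqVneq i j.
  by rewrite !opol0 // => w Ew; apply: c0; rewrite ?size_rcons ?Ew ?mem_rcons
                                                  ?mem_head.
apply: IHm => w Ew jw; apply: c0; first by rewrite size_rcons Ew.
by rewrite mem_rcons inE jw orbT.
Qed.

Definition operator_algebra (B : set (V -> V)) : Prop :=
  [/\ forall b, B b -> forall a u v, b (a *: u + v) = a *: b u + b v,
      forall a, B ( *:%R a),
      forall b b', B b -> B b' -> B (fun v => b v + b' v)
    & forall b b', B b -> B b' -> B (b \o b')].

Lemma opol_closed (B : set (V -> V)) m c x : operator_algebra B ->
  (forall i, B (x i)) -> B (opol m c x).
Proof.
move=> [_ BZ BD BM] Bx; elim: m c => [|m IHm] c; first exact: BZ.
pose f j v := opol m (fun w => c (rcons w j)) x (x j v).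
suff : B (fun v => \sum_(j < d) f j v) by [].
elim: (index_enum _) => [|j r IHr].
  rewrite (_ : (fun v => _) = *:%R 0); first exact: BZ.
  by apply/funext => v; rewrite big_nil scale0r.
rewrite (_ : (fun v => _) = (fun v => f j v + \sum_(i <- r) f i v)).
  by apply: BD => //; apply: (BM (opol m _ x) (x j)).
by apply/funext => v; rewrite big_cons.
Qed.

(* For operators x_i killing us and u, and y killing us with y u <> 0, only   *)
(* the terms of p(x)u ending in the variable specialised to b y survive; so   *)
(* the cofactor q of that last variable, of degree one less, satisfies        *)
(* q(x) b y u = 0 for all b, hence q(x) = 0.                                  *)
Lemma opol_annihilator (B : set (V -> V)) m c (us : seq V) :
    operator_algebra B ->
    (forall u b, u <> 0 -> B b -> (forall b', B b' -> b (b' u) = 0) ->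
       forall v, b v = 0) ->
    (exists v : V, v <> 0) ->
    (exists2 w, size w = m & c w != 0) ->
    (forall w, size w = m -> c w != 0 -> uniq w) ->
    (forall x, (forall i, B (x i) /\ forall u, u \in us -> x i u = 0) ->
       forall v, opol m c x v = 0) ->
  exists us' : seq V, forall b, B b -> (forall u, u \in us' -> b u = 0) ->
    forall v, b v = 0.
Proof.
move=> algB faithB [v0 v0n]; have [BL BZ BD BM] := algB.
have B0 b : B b -> b 0 = 0.
  by move=> Bb; have := BL b Bb (-1) 0 0; rewrite scaler0 addr0 scaleN1r addNr.
elim: m c us => [|m IHm] c us [w0 Ew0 cw0] cU Hc.
  have Hx (i : 'I_d) : B ( *:%R 0) /\ forall u : V, u \in us -> 0 *: u = 0.
    by split=> // u _; rewrite scale0r.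
  have /eqP := Hc (fun=> *:%R 0) Hx v0.
  by rewrite /= scaler_eq0 -(size0nil Ew0) (negPf cw0) => /eqP.
have [|/existsNP[y /not_implyP[By /not_implyP[yus /existsNP[u yu]]]]] := pselect
    (forall b, B b -> (forall u, u \in us -> b u = 0) -> forall v, b v = 0).
  by exists us.
case/lastP: w0 => [//|w0 j] in Ew0 cw0.
apply: (IHm (fun w => c (rcons w j)) (u :: us)).
- by exists w0 => //; move: Ew0; rewrite size_rcons => -[].
- move=> w Ew /cU; rewrite size_rcons Ew rcons_uniq => /(_ erefl) /andP[] //.
move=> x Hx; apply: (faithB _ _ yu).
  by apply: opol_closed => // i; have [] := Hx i.
move=> b Bb; pose x' i := if i == j then b \o y else x i.
have Hx' i : B (x' i) /\ forall u0, u0 \in us -> x' i u0 = 0.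
  rewrite /x'; case: eqP => _; last first.
    have [Bx xus] := Hx i; split=> // u0 u0us; apply: xus.
    by rewrite inE u0us orbT.
  by split=> [|u0 /yus /= ->]; [apply: BM | apply: B0].
have := Hc x' Hx' u; rewrite /= (bigD1 j) //= big1 ?addr0 => [|i ij].
  rewrite {2}/x' eqxx /= => <-; apply: (opol_indep (j := j)) => [w Ew jw|i ij]; last first.
    by rewrite /x' (negPf ij).
  apply/eqP; apply: contraT => /cU; rewrite size_rcons Ew rcons_uniq jw.
  by move=> /(_ erefl) /andP[].
rewrite {2}/x' (negPf ij) (Hx i).2 ?mem_head //.
by apply: B0; apply: opol_closed => // i'; have [] := Hx' i'.
Qed.

End Operators.

End MultilinearPolynomials.

Definition multilinear_identity (k : fieldType) (A : algType k) : Prop :=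
  exists d (c : seq 'I_d -> k), multilinear c /\ forall x : 'I_d -> A, pol d c x = 0.

Lemma converse_multilinear_identity (k : fieldType) (A : algType k) :
  multilinear_identity A -> multilinear_identity A^c.
Proof.
move=> [d [c [[[w Ew cw] cU] Hc]]]; exists d, (c \o rev); split; first split.
- by exists (rev w); rewrite ?size_rev //= revK.
- by move=> v Ev /= /cU; rewrite size_rev rev_uniq; apply.
move=> x; have := Hc x; rewrite pol_converse (_ : _ \o rev = c) //.
by apply/funext => v /=; rewrite revK.
Qed.

(** By [opol_annihilator], finitely many elements [us] of [A/L] have common annihilator [P]. Were
    [L/P] essential in [A/P], so would be the annihilator of each element and every finite
    intersection of these; the zero ideal of [A/P] would then be essential. *)
Lemma pi_faithful_nonessential (k : fieldType) (A : algType k) :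
  multilinear_identity A -> faithful_nonessential A.
Proof.
move=> [d [c [[cn cU] Hc]]] P L P2 Ll sPL L1 PL.
have [P0 PB PMl PMr] := (two_sided_idealP P).1 P2.
have [L0 LB LM] := (left_idealP L).1 Ll.
pose N := @Submod A A^o L Ll; pose V := restrict_scalars (quot_mod N).
pose B := [set b : V -> V | exists a : A, b = *:%R a :> (quot_mod N -> quot_mod N)].
have algB : operator_algebra B.
  split=> [_ [a ->] e u v|e|_ _ [a ->] [a' ->]|_ _ [a ->] [a' ->]].
  - by rewrite scalerDr scaler_restrictA.
  - by exists e%:A.
  - by exists (a + a'); apply/funext => v; rewrite scalerDl.
  - by exists (a * a'); apply/funext => v; rewrite -scalerA.
have [|||us Hus] := @opol_annihilator k d V B d c [::] algB _ _ cn cU _.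
- move=> u _ u0 [a ->] Ha v; have [b Eb] := mod_pi_surj (u : quot_mod N).
  have [e Ee] := mod_pi_surj (v : quot_mod N).
  have Pa : P a.
    apply: (PL b) => [Lb|f]; first by apply: u0; rewrite -Eb; apply/mod_pi_eq0.
    apply/(mod_pi_eq0 N); have := Ha _ (ex_intro _ f erefl).
    by rewrite -Eb -!mod_piZ => <-; congr mod_pi; rewrite -[LHS]mulrA.
  by rewrite -Ee -mod_piZ; apply/mod_pi_eq0/sPL/PMr.
- by exists (mod_pi N (1 : A)) => /mod_pi_eq0.
- move=> x Hx v; have /choice[a Ea] : forall i, exists a : A,
      x i = *:%R a :> (quot_mod N -> quot_mod N) by move=> i; have [] := Hx i.
  by rewrite (funext Ea) (@opol_scale k d A (quot_mod N)) Hc scale0r.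
apply: contrapT => noJ.
have essL (J : set A) : left_ideal J -> J `&` L `<=` P -> J `<=` P.
  by move=> Jl JL; apply: contrapT => nJP; apply: noJ; exists J.
have essA (us' : seq (quot_mod N)) (J : set A) : left_ideal J ->
    (forall a, J a -> (forall u : quot_mod N, u \in us' -> a *: u = 0) -> P a) ->
    J `<=` P.
  elim: us' J => [|u us' IH] J Jl H; first by move=> a Ja; apply: H.
  have [J0 JB JM] := (left_idealP J).1 Jl.
  have [b Eb] := mod_pi_surj u.
  have Lb a : a *: u = 0 <-> L (a * b).
    by rewrite -Eb -mod_piZ; apply: (mod_pi_eq0 N).
  have JLb : [set a | J a /\ L (a * b)] `<=` P.
    apply: IH.
      apply/left_idealP; split=> [|x y [Jx Lx] [Jy Ly]|e x [Jx Lx]] /=.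
      - by rewrite mul0r.
      - by rewrite mulrBl; split; [apply: JB | apply: LB].
      - by rewrite -mulrA; split; [apply: JM | apply: LM].
    move=> a [Ja /Lb au] aus; apply: H => // v; rewrite inE.
    by move=> /predU1P[->|/aus].
  (* [J b] meets [L] inside [P], so essentiality puts [J b] in [P]; hence [J] annihilates [u]. *)
  have JbP : [set x | exists2 a, J a & x = a * b] `<=` P.
    apply: essL => [|_ [[a Ja ->] Lab]]; last by apply: PMr; apply: JLb.
    apply/left_idealP; split=> [|_ _ [x Jx ->] [y Jy ->]|e _ [x Jx ->]].
    - by exists 0; rewrite ?mul0r.
    - by exists (x - y); [apply: JB | rewrite mulrBl].
    - by exists (e * x); [apply: JM | rewrite mulrA].
  by move=> a Ja; apply: JLb; split=> //; apply/sPL/JbP; exists a.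
apply: (L1); apply: sPL; apply: (essA us setT) => // a _ aus.
apply: (PL 1) => // e; rewrite mulr1.
apply/(mod_pi_eq0 N); have := Hus _ (ex_intro _ a erefl) aus (mod_pi N (e : A)).
by rewrite -mod_piZ.
Qed.

Section Linearization.
Variables (k : fieldType) (A : algType k) (d : nat).
Implicit Types (c : seq 'I_d -> k) (x : 'I_d -> A).

Lemma pol0 m c x : (forall w, size w = m -> c w = 0) -> pol m c x = 0.
Proof.
elim: m c => [|m IHm] c c0 /=; first by rewrite c0 ?scale0r.
by rewrite big1 // => j _; rewrite IHm ?mul0r // => w Ew; rewrite c0 ?size_rcons ?Ew.
Qed.

Lemma pol_linear m a c c' x :
  pol m (fun w => a * c w + c' w) x = a *: pol m c x + pol m c' x.
Proof.
elim: m c c' => [|m IHm] c c' /=; first by rewrite scalerDl scalerA.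
rewrite scaler_sumr -big_split; apply: eq_bigr => j _.
by rewrite IHm mulrDl scalerAl.
Qed.

Lemma pol_sum (I : Type) (r : seq I) (P : pred I) (C : I -> seq 'I_d -> k)
    (a : I -> k) m x :
  \sum_(i <- r | P i) a i *: pol m (C i) x =
  pol m (fun w => \sum_(i <- r | P i) a i * C i w) x.
Proof.
elim: r => [|i r IHr].
  by rewrite big_nil pol0 // => w _; rewrite big_nil.
rewrite big_cons IHr; case: ifP => Pi; last first.
  by congr pol; apply/funext => w; rewrite big_cons Pi.
by rewrite -pol_linear; congr pol; apply/funext => w; rewrite big_cons Pi.
Qed.

Definition annul x (j : 'I_d) : 'I_d -> A := fun i => if i == j then 0 else x i.

Lemma pol_annul m c x j :
  pol m c (annul x j) = pol m (fun w => if j \in w then 0 else c w) x.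
Proof.
elim: m c => [//|m IHm] c /=; apply: eq_bigr => i _; rewrite IHm /annul.
have [->|ij] := eqVneq i j.
  by rewrite mulr0 pol0 ?mul0r // => w _; rewrite mem_rcons mem_head.
congr (pol m _ x * _); apply/funext => w.
by rewrite mem_rcons inE eq_sym (negPf ij).
Qed.

Definition delta (j : 'I_d) (h : ('I_d -> A) -> A) x := h x - h (annul x j).

Lemma foldr_delta_pol (l : seq 'I_d) m c :
  foldr delta (pol m c) l = pol m (fun w => if all [in w] l then c w else 0).
Proof.
elim: l => [//|j l /= ->]; apply/funext => x.
rewrite /delta pol_annul -scaleN1r addrC -pol_linear; congr pol.
apply/funext => w /=; case: (j \in w) => /=.
  by rewrite mulr0 add0r.
by rewrite mulN1r addNr.
Qed.

Lemma foldr_delta_sum (l : seq 'I_d) (I : Type) (r : seq I)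
    (h : I -> ('I_d -> A) -> A) (a : I -> k) :
  foldr delta (fun x => \sum_(i <- r) a i *: h i x) l =
  fun x => \sum_(i <- r) a i *: foldr delta (h i) l x.
Proof.
elim: l => [//|j l /= ->]; apply/funext => x; rewrite /delta -sumrB.
by apply: eq_bigr => i _; rewrite -scalerBr.
Qed.

Lemma prod_sum_pol (I : eqType) (f : 'I_d -> I) (w : seq I) x :
  \prod_(i <- w) (\sum_(j < d | f j == i) x j) =
  pol (size w) (fun v => (map f v == w)%:R) x.
Proof.
elim/last_ind: w => [|w i IHw]; first by rewrite big_nil /= scale1r.
rewrite -cats1 big_cat big_seq1 /= IHw cats1 size_rcons /= mulr_sumr big_mkcond.
apply: eq_bigr => j _; case: ifP => fji.
  congr (pol _ _ x * _); apply/funext => v.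
  by rewrite map_rcons eqseq_rcons fji andbT.
by rewrite pol0 ?mul0r // => v _; rewrite map_rcons eqseq_rcons fji andbF.
Qed.

End Linearization.

(* Let w0 be a longest monomial of p, of length d.  In p substitute for each  *)
(* variable i the sum of the new variables x_j with i the j-th letter of w0,  *)
(* then apply all the operators delta j: this keeps the monomials containing  *)
(* all of the x_j, and those have degree d.                                   *)
Lemma polynomial_multilinear_identity (k : fieldType) (A : algType k) :
  polynomial_identity A -> multilinear_identity A.
Proof.
move=> [p p0 Hp].
have [w0 pw0 w0max] : exists2 w0, w0 \in msupp p &
    forall w, w \in msupp p -> (size (w : seq nat) <= size (w0 : seq nat))%N.
  have [E|[w1 w1p]] := fset_0Vmem (msupp p).
    by rewrite -msupp_eq0 E eqxx in p0.
  have [w _ wmax] := @arg_maxnP _ [` w1p]%fset xpredT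
    (fun w : msupp p => size (val w : seq nat)) isT.
  exists (val w); first exact: valP.
  by move=> v pv; apply: (wmax [` pv]%fset).
pose d := size (w0 : seq nat); pose f (j : 'I_d) := nth 0%N w0 j.
pose full (v : seq 'I_d) := all [in v] (enum 'I_d).
pose C (w : {fmonom nat}) (v : seq 'I_d) : k :=
  if full v then (map f v == w :> seq nat)%:R else 0.
pose c v := \sum_(w <- msupp p | size (w : seq nat) == d) p@_w * C w v.
have fullP v : full v -> (d <= size v)%N /\ (size v = d -> uniq v).
  move=> /allP fv.
  have sub : {subset enum 'I_d <= v} by move=> j /fv.
  have Ed : size (enum 'I_d) = d by rewrite size_enum_ord.
  rewrite -{1}Ed uniq_leq_size ?enum_uniq //; split=> // Ev.
  by apply: (leq_size_uniq (enum_uniq 'I_d) sub); rewrite Ed Ev.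
exists d, c; split; first split.
- exists (enum 'I_d); first by rewrite size_enum_ord.
  (* At the word listing the variables in order only [w0] contributes, with its nonzero coefficient
     in [p]. *)
  rewrite /c big_mkcond (bigD1_seq w0) ?fset_uniq //= eqxx big1 => [|w ww0].
    rewrite addr0 /C (_ : full _ = true); last by apply/allP => j.
    have -> : map f (enum 'I_d) = w0.
      by rewrite (map_comp (nth 0%N w0) val) val_enum_ord map_nth_iota0 ?take_size.
    by rewrite eqxx mulr1 mcoeff_neq0.
  case: ifP => // _; rewrite /C; case: ifP; rewrite ?mulr0 //.
  rewrite (map_comp (nth 0%N w0) val) val_enum_ord map_nth_iota0 ?take_size //.
  move=> _; case: eqP => [E|]; rewrite ?mulr0 //.
  by case/eqP: ww0; apply: val_inj.
- move=> v Ev; apply: contraR => nu; apply/eqP; rewrite /c big1 // => w _.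
  rewrite /C; case: ifP => [/fullP[_ /(_ Ev)]|]; last by rewrite mulr0.
  by rewrite (negPf nu).
move=> x.
pose a (x : 'I_d -> A) i := \sum_(j < d | f j == i) x j.
(* The value of [p] under the substitution [a], expanded in the new variables. *)
pose h (x : 'I_d -> A) := \sum_(w <- msupp p)
  p@_w *: pol (size (w : seq nat)) (fun v => (map f v == w :> seq nat)%:R) x.
have h0 : h = fun=> 0.
  apply/funext => y; rewrite -(Hp (a y)) mmapE; apply: eq_bigr => w _.
  by rewrite -(prod_sum_pol f) /= -scalerAl mul1r.
have : foldr (@delta k A d) h (enum 'I_d) x = 0.
  rewrite h0; elim: (enum 'I_d) x => [//|j l IHl] y /=.
  by rewrite /delta !IHl subrr.
rewrite foldr_delta_sum => <-; rewrite /c -pol_sum [LHS]big_mkcond.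
apply: eq_big_seq => w pw; rewrite foldr_delta_pol; case: eqP => [->|Ed].
  by congr (_ *: pol _ _ _).
(* Monomials shorter than [d] cannot contain all the variables, and [p] has none longer. *)
rewrite pol0 ?scaler0 // => v Ev; case: ifP => // /fullP[dv _].
by case: Ed; apply/eqP; rewrite eqn_leq w0max // -Ev.
Qed.

(** * Zariski's lemma *)

Definition generated (R : nzRingType) (R0 : set R) (l : seq R) : set R :=
  [set x | forall S : set R, subring_set S -> R0 `<=` S ->
     (forall y, y \in l -> S y) -> S x].

Lemma generated_subring (R : nzRingType) (R0 : set R) (l : seq R) :
  subring_set (generated R0 l).
Proof.
split=> [S []//|x y Hx Hy S sS R0S lS|x y Hx Hy S sS R0S lS].
  by have [_ SB _] := sS; apply: SB; [apply: Hx | apply: Hy].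
by have [_ _ SM] := sS; apply: SM; [apply: Hx | apply: Hy].
Qed.

Lemma subring_range (R S : nzRingType) (iota : {rmorphism R -> S}) :
  subring_set (range iota).
Proof.
split=> [|_ _ [x _ <-] [y _ <-]|_ _ [x _ <-] [y _ <-]].
- by exists 1; rewrite ?rmorph1.
- by exists (x - y); rewrite ?rmorphB.
- by exists (x * y); rewrite ?rmorphM.
Qed.

Lemma span_tower (K : fieldType) (V : lmodType K) (C C' : set K)
    (f : seq K^o) (e : seq V) x :
  subring_set C -> (forall y : K^o, C' y -> span C f y) -> span C' e x ->
  span C [seq y *: v | y <- f, v <- e] x.
Proof.
move=> sC Hf; have sE := span_stable [seq y *: v | y <- f, v <- e] sC.
have [E0 EB EZ] := sE; move: x; apply: span_ind => // [x y|y v /Hf fy ve].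
  exact: stableD sE.
move: y fy; apply: (@span_min K K^o _ _ [set y | span _ _ (y *: v)]).
  split=> [|y z Hy Hz|c y Cc Hy] /=; first by rewrite scale0r.
    by rewrite scalerBl; apply: EB.
  by rewrite -scalerA; apply: EZ.
by move=> y yf; apply: mem_span => //; apply: allpairs_f.
Qed.

(* The lattice spanned by a basis of V over the ring generated by the         *)
(* structure constants of the operators T is stable, hence all of V.          *)
Lemma irreducible_scalars_generated (F K : fieldType) (iota : {rmorphism F -> K})
    (V : lmodType K) (F0 : set F) (s : nat) (T : 'I_s -> V -> V) (e : seq V) :
    (forall x, span (range iota) e x) -> (exists v : V, v <> 0) ->
    (forall t a u v, T t (iota a *: u + v) = iota a *: T t u + T t v) ->
    (forall W : set V, stable [set iota x | x in F0] W ->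
       (forall t v, W v -> W (T t v)) -> (exists2 v, W v & v <> 0) ->
       forall v, W v) ->
  exists l : seq F, forall x, generated F0 l x.
Proof.
move=> He [v0 v0n] TL Tirr; have sR := subring_range iota.
have [|n [g [gS gI]]] := exists_basis sR _ He.
  by move=> _ [x _ <-]; exists x^-1; rewrite ?fmorphV.
have /choice[co Hco] : forall v, exists a : 'I_n -> F,
    v = \sum_(i < n) iota (a i) *: g i.
  move=> v; have [a Ra ->] := gS v.
  have /choice[b Hb] : forall i, exists b, a i = iota b.
    by move=> i; have [b _ <-] := Ra i; exists b.
  by exists b; apply: eq_bigr => i _; rewrite Hb.
have gI' (a b : 'I_n -> F) : \sum_(i < n) iota (a i) *: g i =
    \sum_(i < n) iota (b i) *: g i -> forall i, a i = b i.
  move=> E i; apply/eqP; rewrite -subr_eq0 -(fmorph_eq0 iota); apply/eqP.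
  apply: (gI (fun i => iota (a i - b i))) => [j|]; first by exists (a j - b j).
  apply/eqP; under eq_bigr do rewrite rmorphB scalerBl.
  by rewrite sumrB subr_eq0; apply/eqP.
have i0 : 'I_n.
  case: n g co {gS gI gI'} Hco => [g co Hco|n *]; last exact: ord0.
  by case: v0n; rewrite (Hco v0) big_ord0.
pose l := [seq co (T p.1 (g p.2.1)) p.2.2 | p <- enum {: 'I_s * ('I_n * 'I_n)}].
exists l; pose C := generated F0 l.
have sC : subring_set C := generated_subring F0 l; have [C1 CB CM] := sC.
have C0 : C 0 by rewrite -(subrr 1); apply: CB.
have lC y : y \in l -> C y by move=> yl S _ _; apply.
pose W := [set v | forall i, C (co v i)].
have WE (a : 'I_n -> F) : (forall i, C (a i)) ->
    W (\sum_(i < n) iota (a i) *: g i).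
  by move=> Ca i; rewrite -(gI' _ _ (Hco _)).
have W0 : W 0.
  rewrite [0](_ : _ = \sum_(i < n) iota ((fun=> 0) i) *: g i); first exact: WE.
  by rewrite big1 // => i _; rewrite rmorph0 scale0r.
have WB u v : W u -> W v -> W (u - v).
  move=> Wu Wv; rewrite (Hco u) (Hco v) -sumrB.
  under eq_bigr do rewrite -scalerBl -rmorphB.
  by apply: (WE (fun i => co u i - co v i)) => i; apply: CB.
have WZ c v : C c -> W v -> W (iota c *: v).
  move=> Cc Wv; rewrite (Hco v) scaler_sumr.
  under eq_bigr do rewrite scalerA -rmorphM.
  by apply: (WE (fun i => c * co v i)) => i; apply: CM.
have WD u v : W u -> W v -> W (u + v).
  by move=> Wu Wv; rewrite -[v]opprK; apply: (WB) => //; rewrite -sub0r; apply: WB.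
have Wg i : W (g i).
  rewrite (_ : g i = \sum_(j < n) iota ((fun j => (j == i)%:R) j) *: g j).
    by apply: WE => j; case: (j == i).
  rewrite (bigD1 i) //= eqxx rmorph1 scale1r big1 ?addr0 // => j /negPf ->.
  by rewrite rmorph0 scale0r.
have T0 t : T t 0 = 0.
  have := TL t (-1) 0 0.
  by rewrite scaler0 addr0 rmorphN1 scaleN1r addNr.
have Wall v : W v.
  apply: Tirr => [|t u Wu|].
  - split=> // _ u [c F0c <-] Wu; apply: WZ => // S _ F0S _; exact: F0S.
  - rewrite (Hco u); elim: (index_enum _) => [|i r IHr].
      by rewrite big_nil T0.
    rewrite big_cons TL; apply: WD => //; apply: WZ => // j; apply: lC.
    by apply/mapP; exists (t, (i, j)); rewrite ?mem_enum.
  exists (g i0) => // g0; suff /eqP : (i0 == i0)%:R = 0 :> F.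
    by rewrite eqxx oner_eq0.
  apply: (gI' (fun j => (j == i0)%:R) (fun=> 0)).
  rewrite [RHS]big1 => [|j _]; last by rewrite rmorph0 scale0r.
  rewrite big1 // => j _; have [->|_] := eqVneq j i0; first by rewrite g0 scaler0.
  by rewrite rmorph0 scale0r.
(* The coordinate of [iota x *: g i0] at [i0] is [x], which is therefore in the generated ring. *)
move=> x; have := Wall (iota x *: g i0) i0.
suff -> : co (iota x *: g i0) i0 = x by [].
rewrite -(gI' (fun j => if j == i0 then x else 0) _ _ i0) ?eqxx //.
rewrite -Hco (bigD1 i0) //= eqxx big1 ?addr0 // => j /negPf ->.
by rewrite rmorph0 scale0r.
Qed.

Section Adjoin.
Variables (F K : fieldType) (iota : {rmorphism F -> K}) (c : K).

Local Notation "p ^i" := (map_poly iota p) (at level 2, format "p ^i").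

(** The subfield [F(c)] of [K]; it is made a [fieldType] to become the base field in the induction
    of [zariski]. *)
Definition adjoin_pred : {pred K} := fun x =>
  `[< exists p q : {poly F}, q^i.[c] != 0 /\ x = p^i.[c] / q^i.[c] >].

Let adjoin_closed : divring_closed adjoin_pred.
Proof.
split=> [|_ _ /asboolP[p [q [q0 ->]]] /asboolP[r [s [s0 ->]]]
         |_ _ /asboolP[p [q [q0 ->]]] /asboolP[r [s [s0 ->]]]]; apply/asboolP.
- by exists 1, 1; rewrite rmorph1 hornerC oner_eq0 divr1.
- exists (p * s - r * q), (q * s).
  rewrite rmorphB !rmorphM /= hornerD hornerN !hornerM mulf_neq0 //.
  by split=> //; rewrite -mulNr addf_div ?mulNr.
- have [r0|r0] := eqVneq r^i.[c] 0.
    exists 0, 1; rewrite rmorph0 rmorph1 hornerC horner0 oner_eq0.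
    by rewrite r0 !mul0r invr0 mulr0.
  exists (p * s), (q * r); rewrite !rmorphM !hornerM mulf_neq0 //.
  by split=> //; rewrite invf_div mulf_div.
Qed.

HB.instance Definition _ := GRing.isDivringClosed.Build K adjoin_pred
  adjoin_closed.

Record adjoin := Adjoin { adjoin_val : K; _ : adjoin_val \in adjoin_pred }.

HB.instance Definition _ := [isSub for adjoin_val].
HB.instance Definition _ := [Choice of adjoin by <:].
HB.instance Definition _ := [SubChoice_isSubIntegralDomain of adjoin by <:].
HB.instance Definition _ := [SubIntegralDomain_isSubField of adjoin by <:].

Lemma adjoinP (x : adjoin) : exists p q : {poly F},
  q^i.[c] != 0 /\ val x = p^i.[c] / q^i.[c].
Proof. by case: x => x /= /asboolP. Qed.

Lemma adjoin_horner (p : {poly F}) : p^i.[c] \in adjoin_pred.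
Proof.
by apply/asboolP; exists p, 1; rewrite rmorph1 hornerC oner_eq0 divr1.
Qed.

(* If c is algebraic, then F(c) = F[c] by Bezout, and F[c] is spanned by the  *)
(* powers of c below the degree of a polynomial vanishing at c.               *)
Lemma algebraic_adjoin_span (p : {poly F}) : p != 0 -> p^i.[c] = 0 ->
  exists e : seq K^o, forall x : adjoin, span (range iota) e (val x : K^o).
Proof.
move=> p0 pc.
pose deg n := `[< exists2 q : {poly F}, q != 0 /\ q^i.[c] = 0 & size q = n >].
have exd : exists n, deg n by exists (size p); apply/asboolP; exists p.
case: (ex_minnP exd) => n /asboolP[m [m0 mc] Em] mmin.
(* The gcd of [m] and [g] does not vanish at [c], so its cofactor in [m] does, and minimality of [m]
   makes the gcd constant. *)
have mdvd (g : {poly F}) : g^i.[c] != 0 -> coprimep m g.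
  move=> gc; rewrite /coprimep; set h := gcdp m g.
  have h0 : h != 0 by rewrite gcdp_eq0 negb_and m0.
  have /dvdpP[q Eq] : h %| m := dvdp_gcdl m g.
  have /dvdpP[r Er] : h %| g := dvdp_gcdr m g.
  have hc : h^i.[c] != 0.
    by apply: contraNneq gc => hc; rewrite Er rmorphM hornerM hc mulr0.
  have q0 : q != 0 by apply: contraNneq m0 => q0; rewrite Eq q0 mul0r.
  have qc : q^i.[c] = 0.
    by move: mc; rewrite Eq rmorphM hornerM => /eqP; rewrite mulf_eq0 (negPf hc) orbF
       => /eqP.
  have : (n <= size q)%N by apply: mmin; apply/asboolP; exists q.
  rewrite -Em Eq size_mul // -[X in (_ <= X)%N]addn0 -subn1 leq_subLR addnCA.
  rewrite leq_add2l addn0 => h1; apply/eqP/anti_leq; rewrite h1 /=.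
  by rewrite lt0n size_poly_eq0.
exists [seq (c ^+ (i : 'I_n) : K^o) | i <- enum 'I_n] => x.
have sR := subring_range iota; apply/span_sumP => //.
have [f [g [gc ->]]] := adjoinP x.
have [[u v] /= Euv] := Bezout_eq1_coprimepP _ _ (mdvd g gc).
pose r := (f * v) %% m.
have -> : f^i.[c] / g^i.[c] = r^i.[c].
  have vg : v^i.[c] * g^i.[c] = 1.
    have := congr1 (fun p => p^i.[c]) Euv.
    by rewrite rmorphD !rmorphM rmorph1 hornerD !hornerM hornerC mc mulr0 add0r.
  have -> : g^i.[c]^-1 = v^i.[c] by apply: (mulIf gc); rewrite mulVf.
  rewrite -hornerM -rmorphM {1}(divp_eq (f * v) m) rmorphD rmorphM hornerD hornerM.
  by rewrite mc mulr0 add0r.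
exists (fun i => iota r`_i) => [i|]; first by exists r`_i.
rewrite (@horner_coef_wide _ n).
  by apply: eq_bigr => i _; rewrite coef_map.
by rewrite size_map_poly ltnW // -Em ltn_modp.
Qed.

(* All elements of a finitely generated ring extension of F[c] inside F(c)    *)
(* have a power of one polynomial b as denominator; 1/(bX + 1) has not.       *)
Lemma generated_adjoin_algebraic (l : seq adjoin) :
    (forall x : adjoin, generated [set y : adjoin | range iota (val y)] l x) ->
  exists2 p : {poly F}, p != 0 & p^i.[c] = 0.
Proof.
move=> gen; apply: contrapT => transc.
have tr (p : {poly F}) : p^i.[c] = 0 -> p = 0.
  by move=> pc; apply: contrapT => /eqP p0; apply: transc; exists p.
have [b bc Hb] : exists2 b : {poly F}, b^i.[c] != 0 &
    forall y, y \in l -> exists p : {poly F}, val y * b^i.[c] = p^i.[c].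
  elim: (l) => [|y l' [b bc Hb]]; first by exists 1; rewrite ?rmorph1 ?hornerC ?oner_eq0.
  have [f [g [gc Ey]]] := adjoinP y.
  exists (g * b) => [|z]; first by rewrite rmorphM hornerM mulf_neq0.
  rewrite inE => /predU1P[->|/Hb[p Ep]].
    by exists (f * b); rewrite Ey !rmorphM !hornerM mulrA divfK.
  by exists (g * p); rewrite !rmorphM !hornerM mulrCA Ep.
pose S := [set x : adjoin | exists n (p : {poly F}), val x * b^i.[c] ^+ n = p^i.[c]].
have SS : subring_set S.
  split=> [|x y [n [p Ep]] [m [q Eq]]|x y [n [p Ep]] [m [q Eq]]].
  - by exists 0%N, 1; rewrite !rmorph1 hornerC expr0 mulr1.
  - exists (n + m)%N, (p * b ^+ m - q * b ^+ n).
    rewrite rmorphB [in RHS]rmorphB !rmorphM !rmorphXn hornerD hornerN !hornerM.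
    rewrite !horner_exp -Ep -Eq mulrBl exprD mulrA; congr (_ - _).
    by rewrite mulrAC mulrA.
  - exists (n + m)%N, (p * q).
    by rewrite !rmorphM hornerM -Ep -Eq exprD mulrACA.
have b0 : b != 0 by apply: contraNneq bc => ->; rewrite rmorph0 horner0.
pose h := b * 'X + 1.
have sh : (1 < size h)%N.
  rewrite /h size_polyDl ?size_mulX //; last by rewrite size_poly1 ltnS lt0n size_poly_eq0.
  by rewrite ltnS lt0n size_poly_eq0.
have h0 : h != 0 by rewrite -size_poly_gt0 (ltn_trans _ sh).
have hc : h^i.[c] != 0 by apply: contraNneq h0 => /tr ->.
have hV : h^i.[c]^-1 \in adjoin_pred by apply: rpredVr; apply: adjoin_horner.
have [n [p Ep]] : S (Adjoin hV).
  apply: gen => // [y [a _ Ea]|y yl].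
    by exists 0%N, a%:P; rewrite expr0 mulr1 -Ea map_polyC hornerC.
  by have [p Ep] := Hb y yl; exists 1%N, p; rewrite expr1.
have Eb : b ^+ n = p * h.
  apply/eqP; rewrite -subr_eq0; apply/eqP/tr.
  rewrite rmorphB rmorphM rmorphXn hornerD hornerN hornerM horner_exp -Ep /=.
  by rewrite mulrAC mulVf // mul1r subrr.
have cop : coprimep (b ^+ n) h.
  apply: coprimep_expl; apply/Bezout_eq1_coprimepP; exists (- 'X, 1) => /=.
  by rewrite /h mul1r mulNr mulrC addrA addNr add0r.
have : coprimep h h by apply: coprimep_dvdr cop; rewrite Eb dvdp_mull.
by rewrite coprimepp => /eqP E; rewrite E in sh.
Qed.

End Adjoin.

(** By induction [K] is finite over [F(c)]. With multiplications by the generators as operators on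
    [K], [irreducible_scalars_generated] shows that [F(c)] is a finitely generated ring over [F],
    which forces [c] to be algebraic; the two finite extensions then compose. *)
Lemma zariski (K : fieldType) (l : seq K) (F : fieldType) (iota : {rmorphism F -> K}) :
  (forall x, generated (range iota) l x) ->
  exists e : seq K^o, forall x : K^o, span (range iota) e x.
Proof.
elim: l F iota => [|c l IHl] F iota gen.
  exists [:: 1] => x; exists x; last by rewrite /= [_ *: _]mulr1 subrr.
  by apply: gen => //; apply: subring_range.
have [|e He] := IHl (adjoin iota c) (val : {rmorphism adjoin iota c -> K}).
  move=> x S sS RS lS; apply: gen => // [_ [a _ <-]|y].
    apply: RS; have ac := adjoin_horner iota c a%:P.
    by exists (Adjoin ac) => //=; rewrite map_polyC hornerC.
  rewrite inE => /predU1P[->|/lS //]; apply: RS.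
  have ac := adjoin_horner iota c 'X.
  by exists (Adjoin ac) => //=; rewrite map_polyX hornerX.
suff [p p0 pc] : exists2 p : {poly F}, p != 0 & (map_poly iota p).[c] = 0.
  have [f Hf] := algebraic_adjoin_span p0 pc.
  exists [seq y *: v | y <- f, v <- e] => x.
  apply: (span_tower (subring_range iota) _ (He x)).
  by move=> _ [y _ <-]; apply: Hf.
have [|t a u v|W sW TW [v Wv v0] z|l' Hl'] := @irreducible_scalars_generated
    (adjoin iota c) K val K^o [set y | range iota (val y)] _
    (fun (t : 'I_(size (c :: l))) (y : K^o) => (c :: l)`_t * y : K^o) e He.
- by exists (1 : K^o); apply/eqP; apply: oner_neq0.
- by rewrite mulrDr; congr (_ + _); rewrite [_ *: _]/(_ * _) mulrCA.
(* The multipliers of [W] form a subring containing [F] and all generators, hence [K]; so [W],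
   having a nonzero element, is everything. *)
- pose S := [set y : K | forall w, W w -> W (y * w)].
  have [W0 WB WZ] := sW.
  suff Sall y : S y by rewrite -[z](divfK (_ : v != 0)); [apply: Sall | apply/eqP].
  apply: gen => [|_ [a _ <-] w Ww|d].
  + split=> [w|x y' Sx Sy w Ww|x y' Sx Sy w Ww]; first by rewrite mul1r.
      by rewrite mulrBl; apply: WB; [apply: Sx | apply: Sy].
    by rewrite -mulrA; apply/Sx/Sy.
  + have ac := adjoin_horner iota c a%:P.
    apply: WZ => //; exists (Adjoin ac); last by rewrite /= map_polyC hornerC.
    by exists a => //=; rewrite map_polyC hornerC.
  + move=> dl w Ww; have ld : (index d (c :: l) < size (c :: l))%N by rewrite index_mem.
    by have := TW (Ordinal ld) w Ww; rewrite /= -[X in _`_X]/(index d (c :: l)) nth_index.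
exact: generated_adjoin_algebraic Hl'.
Qed.

(** * Simple modules over affine algebras with a polynomial identity *)

(** A commutative field of additive operators, kept as a set with closure properties so that Zorn's
    lemma can produce it; it becomes a [fieldType] acting on [V] below. *)
Record operator_field (V : zmodType) := OperatorField {
  opf_set :> set (V -> V);
  opfB : forall f, opf_set f -> forall u v, f (u - v) = f u - f v;
  opf_id : opf_set id;
  opf_sub : forall f g, opf_set f -> opf_set g -> opf_set (fun v => f v - g v);
  opf_comp : forall f g, opf_set f -> opf_set g -> opf_set (f \o g);
  opfC : forall f g, opf_set f -> opf_set g -> f \o g = g \o f;
  opfV : forall f, opf_set f -> (exists v, f v <> 0) ->
    exists2 g, opf_set g & g \o f = id;
  opf_neq0 : exists v : V, v <> 0
}.

Section OperatorField.
Variables (V : zmodType) (S : operator_field V).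

Definition opfield : Type := {f : V -> V | opf_set S f}.

Implicit Types f g h : opfield.

Lemma opfield_inj f g : (forall v, sval f v = sval g v) -> f = g.
Proof. by case: f g => [f Sf] [g Sg] /= /funext E; apply: eq_exist. Qed.

HB.instance Definition _ := gen_eqMixin opfield.
HB.instance Definition _ := gen_choiceMixin opfield.

Let f0 f : sval f 0 = 0.
Proof. by rewrite -[X in sval f X](subrr 0) (opfB (svalP f)) subrr. Qed.

Let fD f u v : sval f (u + v) = sval f u + sval f v.
Proof.
by rewrite -{1}[v]opprK (opfB (svalP f)) -[- v]sub0r (opfB (svalP f)) f0 sub0r opprK.
Qed.

Let osub f g : opfield := exist _ _ (opf_sub (svalP f) (svalP g)).
Let oone : opfield := exist _ _ (opf_id S).
Let ozero : opfield := osub oone oone.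
Let oopp f : opfield := osub ozero f.
Let oadd f g : opfield := osub f (oopp g).
Let omul f g : opfield := exist _ _ (opf_comp (svalP f) (svalP g)).

Let oaddE f g v : sval (oadd f g) v = sval f v + sval g v.
Proof. by rewrite /= subrr sub0r opprK. Qed.

Let oaddA : associative oadd.
Proof. by move=> f g h; apply: opfield_inj => v; rewrite !oaddE addrA. Qed.
Let oaddC : commutative oadd.
Proof. by move=> f g; apply: opfield_inj => v; rewrite !oaddE addrC. Qed.
Let oadd0 : left_id ozero oadd.
Proof. by move=> f; apply: opfield_inj => v; rewrite oaddE /= subrr add0r. Qed.
Let oaddN : left_inverse ozero oopp oadd.
Proof.
by move=> f; apply: opfield_inj => v; rewrite oaddE /= subrr sub0r addNr.
Qed.

HB.instance Definition _ := GRing.isZmodule.Build opfield oaddA oaddC oadd0 oaddN.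

Let omulA : associative omul.
Proof. by move=> f g h; apply: opfield_inj. Qed.
Let omulC : commutative omul.
Proof.
move=> f g; apply: opfield_inj => v.
exact: (congr1 (@^~ v) (opfC (svalP f) (svalP g))).
Qed.
Let omul1 : left_id oone omul.
Proof. by move=> f; apply: opfield_inj. Qed.
Let omulDl : left_distributive omul oadd.
Proof. by move=> f g h; apply: opfield_inj => v; rewrite [RHS]oaddE [LHS]oaddE. Qed.
Let oone_neq0 : oone != ozero.
Proof.
apply/eqP => /(congr1 sval) E; have [v] := opf_neq0 S; apply.
by have := congr1 (@^~ v) E; rewrite /= subrr.
Qed.

HB.instance Definition _ := GRing.Zmodule_isComNzRing.Build opfield
  omulA omulC omul1 omulDl oone_neq0.

Let oinv_spec f : exists g, (f != 0 -> g * f = 1) /\ (f = 0 -> g = 0).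
Proof.
have [->|f_neq0] := eqVneq f 0; first by exists 0.
have [|g Sg gf] := opfV (svalP f).
  apply/existsNP => fz; move/eqP: f_neq0; apply.
  by apply: opfield_inj => v; rewrite fz /= subrr.
exists (exist _ g Sg); split=> [_|f0']; last by rewrite f0' eqxx in f_neq0.
by apply: opfield_inj => v; apply: (congr1 (@^~ v) gf).
Qed.

Let oinv f : opfield := sval (cid (oinv_spec f)).
Let omulV f : f != 0 -> oinv f * f = 1.
Proof. by rewrite /oinv; case: cid => g []. Qed.
Let oinv0 : oinv 0 = 0.
Proof. by rewrite /oinv; case: cid => g /= [_]; apply. Qed.

HB.instance Definition _ := GRing.ComNzRing_isField.Build opfield omulV oinv0.

Definition opmod of operator_field V : Type := V.

HB.instance Definition _ := GRing.Zmodule.on (opmod S).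

Let oscale f (v : opmod S) : opmod S := sval f v.
Let oscaleA f g v : oscale f (oscale g v) = oscale (f * g) v.
Proof. by []. Qed.
Let oscale1 : left_id 1 oscale.
Proof. by []. Qed.
Let oscaleDr : right_distributive oscale +%R.
Proof. by move=> f u v; apply: fD. Qed.
Let oscaleDl v : {morph oscale^~ v : f g / f + g}.
Proof. by move=> f g; apply: oaddE. Qed.

HB.instance Definition _ := GRing.Zmodule_isLmodule.Build opfield (opmod S)
  oscaleA oscale1 oscaleDr oscaleDl.

End OperatorField.

Section OperatorSubstitution.
Variables (k : fieldType) (d : nat) (V : lmodType k).
Implicit Types (c : seq 'I_d -> k) (x : 'I_d -> V -> V) (f g b : V -> V).

Lemma opolD m c x u v : (forall i, {morph x i : u v / u + v}) ->
  opol m c x (u + v) = opol m c x u + opol m c x v.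
Proof.
move=> xD; elim: m c u v => [|m IHm] c u v /=; first exact: scalerDr.
by rewrite -big_split; apply: eq_bigr => i _; rewrite xD IHm.
Qed.

Lemma opol_commute m c x f v : linear f -> (forall i v, x i (f v) = f (x i v)) ->
  opol m c x (f v) = f (opol m c x v).
Proof.
move=> fL xf.
have f0 : f 0 = 0.
  by have := fL (-1) 0 0; rewrite scaler0 addr0 scaleN1r addNr.
elim: m c v => [|m IHm] c v /=.
  by rewrite -[c [::] *: v]addr0 fL f0 addr0.
rewrite (big_morph f (id1 := 0) (op1 := +%R)) // => [|u w].
  by apply: eq_bigr => i _; rewrite xf IHm.
by have := fL 1 u w; rewrite !scale1r.
Qed.

Definition upd x (j : 'I_d) f : 'I_d -> V -> V := fun i => if i == j then f else x i.

(** Linearity in the variable [j], which occurs exactly once in each word; [f] comes out in front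
    because it commutes with all the other operators. *)
Lemma opol_upd m c x j f g b v :
    linear f -> {morph g : u v / u + v} ->
    (forall i, i != j -> {morph x i : u v / u + v}) ->
    (forall i v, i != j -> x i (f v) = f (x i v)) ->
    (forall v, g (f v) = f (g v)) ->
    (forall w, size w = m -> c w != 0 -> uniq w && (j \in w)) ->
  opol m c (upd x j (fun v => f (g v) + b v)) v =
  f (opol m c (upd x j g) v) + opol m c (upd x j b) v.
Proof.
move=> fL gD xD xf gf; have fD u w : f (u + w) = f u + f w.
  by have := fL 1 u w; rewrite !scale1r.
have f0 : f 0 = 0.
  by have := fL (-1) 0 0; rewrite scaler0 addr0 scaleN1r addNr.
have uD i : {morph upd x j g i : u v / u + v}.
  by rewrite /upd; case: eqVneq => [_|/xD].
have uf i w : upd x j g i (f w) = f (upd x j g i w).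
  by rewrite /upd; case: eqVneq => [_|/xf].
elim: m c v => [|m IHm] c v cH /=.
  rewrite (_ : c [::] = 0) ?scale0r ?f0 ?addr0 //.
  by apply/eqP; apply: contraT => /cH; rewrite in_nil andbF => /(_ erefl).
rewrite (big_morph f (id1 := 0) (op1 := +%R)) // -big_split.
apply: eq_bigr => i _ /=; rewrite /upd; case: eqVneq => [->|ij]; last first.
  apply: (IHm (fun w => c (rcons w i))) => w Ew /cH.
  rewrite size_rcons Ew rcons_uniq mem_rcons inE eq_sym (negPf ij) /=.
  by move=> /(_ erefl) /andP[/andP[_ ->] ->].
have cj w : size w = m -> j \in w -> c (rcons w j) = 0.
  move=> Ew jw; apply/eqP; apply: contraT => /cH.
  by rewrite size_rcons Ew rcons_uniq jw => /(_ erefl).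
have indep (h h' : V -> V) w : opol m (fun w => c (rcons w j)) (upd x j h) w =
    opol m (fun w => c (rcons w j)) (upd x j h') w.
  by apply: (opol_indep (j := j)) => // l lj; rewrite /upd (negPf lj).
rewrite -![opol _ _ (fun _ => _) _]/(opol _ _ (upd _ _ _) _).
rewrite (indep _ g) opolD // opol_commute //; congr (_ + _); exact: indep.
Qed.

End OperatorSubstitution.

Section SimpleModule.
Variables (k : fieldType) (A : algType k) (M : lmodType A).
Hypothesis Msimple : simple_module M.

Definition mod_endo (f : M -> M) : Prop :=
  forall (a : A) u v, f (a *: u + v) = a *: f u + f v.

Lemma mod_endo0 f : mod_endo f -> f 0 = 0.
Proof.
by move=> fL; have := fL (-1) 0 0; rewrite scaler0 addr0 scaleN1r addNr.
Qed.

Lemma mod_endoZ f a u : mod_endo f -> f (a *: u) = a *: f u.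
Proof. by move=> fL; rewrite -[a *: u]addr0 fL mod_endo0 // addr0. Qed.

Lemma mod_endoB f u v : mod_endo f -> f (u - v) = f u - f v.
Proof. by move=> fL; rewrite addrC -scaleN1r fL scaleN1r addrC. Qed.

Lemma schur f : mod_endo f -> (exists v, f v <> 0) ->
  exists g, [/\ mod_endo g, g \o f = id & f \o g = id].
Proof.
move=> fL [v0 fv0]; have [_ Msub] := Msimple.
have finj u v : f u = f v -> u = v.
  move=> E; have [|K|K] := Msub [set w | f w = 0].
  - split=> [|a w w' /= fw fw']; first exact: mod_endo0.
    by rewrite fL fw fw' scaler0 addr0.
  - apply/eqP; rewrite -subr_eq0; apply/eqP.
    suff : [set w | f w = 0] (u - v) by rewrite K.
    by rewrite /= mod_endoB // E subrr.
  - by have : [set: M] v0 by []; rewrite -K.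
have [|I|I] := Msub [set f w | w in setT].
- split=> [|a _ _ [u _ <-] [v _ <-]]; first by exists 0; rewrite ?mod_endo0.
  by exists (a *: u + v).
- have : [set f w | w in setT] (f v0) by exists v0.
  by rewrite I => /fv0.
have /choice[g fg] : forall w, exists u, f u = w.
  by move=> w; have : [set: M] w by []; rewrite -I => -[u _ <-]; exists u.
exists g; split; [|apply/funext => u; apply: finj; exact: fg | apply/funext => u; exact: fg].
by move=> a u v; apply: finj; rewrite fL !fg.
Qed.

(** A maximal set of pairwise commuting endomorphisms contains every endomorphism commuting with it;
    this gives closure under differences, products and, by [schur], inverses. *)
Lemma exists_max_operator_field : exists S : operator_field M,
  (forall f, opf_set S f -> mod_endo f) /\
  (forall f, mod_endo f -> (forall g, opf_set S g -> f \o g = g \o f) ->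
     opf_set S f).
Proof.
pose P := [set X : set (M -> M) | (forall f, X f -> mod_endo f) /\
  (forall f g, X f -> X g -> f \o g = g \o f)].
have [|S [[SL SC] Smax]] := @Zorn_bigcup (M -> M) P.
  move=> F FP totF; split=> [f [X FX Xf]|f g [X FX Xf] [Y FY Yg]].
    by apply: (FP X FX).1.
  have [XY|YX] := totF X Y FX FY; first by apply: (FP Y FY).2 => //; apply: XY.
  by apply: (FP X FX).2 => //; apply: YX.
have Smem f : mod_endo f -> (forall g, S g -> f \o g = g \o f) -> S f.
  move=> fL fC; apply: contrapT => Sf.
  apply: (Smax (S `|` [set f])).
    split; first by move=> g Sg; left.
    by move/(_ f); apply: contra_not Sf => /(_ (or_intror erefl)).
  split=> [g [/SL //|->] //|g h [Sg|->] [Sh|->] //]; first exact: SC.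
    by rewrite fC.
  exact: fC.
have SE f g v : S f -> S g -> f (g v) = g (f v).
  by move=> Sf Sg; apply: (congr1 (@^~ v) (SC f g Sf Sg)).
have [[v0 v0n] _] := Msimple.
suff [S' ES'] : exists S' : operator_field M, opf_set S' = S.
  by exists S'; rewrite ES'.
unshelve eexists (@OperatorField M S _ _ _ _ _ _ _) => //.
- by move=> f /SL fL u v; apply: mod_endoB.
- by apply: Smem.
- move=> f g Sf Sg; have [fL gL] := (SL f Sf, SL g Sg).
  apply: Smem => [a u v|h Sh]; first by rewrite fL gL opprD addrACA scalerBr.
  by apply/funext => v /=; rewrite (mod_endoB _ _ (SL h Sh)) (SE h f) // (SE h g).
- move=> f g Sf Sg; have [fL gL] := (SL f Sf, SL g Sg).
  apply: Smem => [a u v|h Sh]; first by rewrite /= gL fL.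
  by apply/funext => v /=; rewrite (SE h f) // (SE h g).
- move=> f Sf fn; have [g [gL gf fg]] := schur (SL f Sf) fn.
  exists g => //; apply: Smem => // h Sh; apply/funext => v /=.
  rewrite -[v in LHS](congr1 (@^~ v) fg) /= -(SE f) //.
  exact: (congr1 (@^~ _) gf).
- by exists v0.
Qed.

Variable S : operator_field M.
Hypothesis Sendo : forall f, opf_set S f -> mod_endo f.
Hypothesis Smax : forall f, mod_endo f ->
  (forall g, opf_set S g -> f \o g = g \o f) -> opf_set S f.

Lemma opf_apply f g v : opf_set S f -> opf_set S g -> f (g v) = g (f v).
Proof. by move=> Sf Sg; apply: (congr1 (@^~ v) (opfC Sf Sg)). Qed.

Let V := restrict_scalars M.

(* The operators of the algebra generated by A and the field S. *)
Inductive opgen : (V -> V) -> Prop :=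
| Opgen0 : opgen (fun=> 0)
| OpgenD (a : A) (f : M -> M) (b : V -> V) : opf_set S f -> opgen b ->
    opgen (fun v => f (a *: (v : M)) + b v).

Lemma opgen_scale a : opgen (fun v => a *: (v : M)).
Proof.
have := OpgenD a (opf_id S) Opgen0; congr opgen; apply/funext => v.
exact: addr0.
Qed.

Lemma opgenD b b' : opgen b -> opgen b' -> opgen (fun v => b v + b' v).
Proof.
move=> ob ob'; elim: ob => [|a f b1 Sf _ IH].
  by congr opgen: ob'; apply/funext => v; rewrite add0r.
by have := OpgenD a Sf IH; congr opgen; apply/funext => v; rewrite addrA.
Qed.

Lemma opgen_field f b : opf_set S f -> opgen b -> opgen (f \o b).
Proof.
move=> Sf; have fL := Sendo Sf; elim=> [|a g b1 Sg _ IH].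
  by have := Opgen0; congr opgen; apply/funext => v /=; rewrite mod_endo0.
have := OpgenD a (opf_comp Sf Sg) IH; congr opgen; apply/funext => v /=.
by have := fL 1 (g (a *: (v : M))) (b1 v); rewrite !scale1r.
Qed.

Lemma opgenZ a b : opgen b -> opgen (fun v => a *: (b v : M)).
Proof.
elim=> [|a' g b1 Sg _ IH].
  by have := Opgen0; congr opgen; apply/funext => v /=; rewrite scaler0.
have := OpgenD (a * a') Sg IH; congr opgen; apply/funext => v /=.
by rewrite scalerDr -scalerA (mod_endoZ _ _ (Sendo Sg)).
Qed.

Lemma opgen_commute b f v : opgen b -> opf_set S f -> b (f v) = f (b v).
Proof.
move=> ob Sf; have fL := Sendo Sf; elim: ob => [|a g b1 Sg _ IH].
  by rewrite mod_endo0.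
rewrite IH -(mod_endoZ a v fL) (opf_apply _ Sg Sf).
by have := fL 1 (g (a *: v)) (b1 v); rewrite !scale1r.
Qed.

Lemma opgen_algebra : operator_algebra opgen.
Proof.
split=> [b ob a u v|a|b b' ob ob'|b b' ob ob'].
- elim: ob => [|a' f b1 Sf _ IH]; first by rewrite scaler0 addr0.
  have -> : f (a' *: (a *: u + v : M)) =
      a *: (f (a' *: (u : M)) : V) + f (a' *: (v : M)).
    rewrite scalerDr scaler_restrictA.
    exact: (Sendo Sf a%:A (a' *: (u : M)) (a' *: (v : M))).
  by rewrite IH [a *: (_ + _)]scalerDr; apply: addrACA.
- exact: opgen_scale.
- exact: opgenD.
elim: ob => [|a f b1 Sf ob1 IH]; first exact: Opgen0.
apply: (opgenD _ IH); apply: (opgen_field Sf (opgenZ a ob')).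
Qed.

(** A multilinear identity survives the extension of scalars to [S]. The variables in [l] may take
    values in [opgen], the others in [A]; [opol_upd] moves them over one at a time. *)
Lemma opgen_identity (d : nat) (c : seq 'I_d -> k) :
    multilinear c -> (forall x : 'I_d -> A, pol d c x = 0) ->
  forall x, (forall i, opgen (x i)) -> forall v, opol d c x v = 0.
Proof.
move=> [_ cU] Hc; have cH j w : size w = d -> c w != 0 -> uniq w && (j \in w).
  move=> Ew /(cU w Ew) Uw; rewrite Uw /=.
  have /subset_cardP E : #|w| = #|'I_d| by rewrite (card_uniqP Uw) card_ord.
  by have /E -> : w \subset 'I_d by apply/fintype.subsetP.
suff main (l : seq 'I_d) (x : 'I_d -> V -> V) v :
    (forall i, i \in l -> opgen (x i)) ->
    (forall i, i \notin l -> exists a : A, x i = *:%R a :> (M -> M)) ->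
    opol d c x v = 0.
  move=> x ox v; apply: (main (enum 'I_d)) => i //.
  by rewrite mem_enum.
elim: l x v => [|j l IHl] x v ol al.
  have /choice[a Ea] : forall i, exists a : A, x i = *:%R a :> (M -> M).
    by move=> i; apply: al.
  by rewrite (funext Ea) (@opol_scale k d A M) Hc scale0r.
have ox i : opgen (x i).
  by have [/ol //|/al[a ->]] := boolP (i \in j :: l); apply: opgen_scale.
have -> : x = upd x j (x j).
  by apply/funext => i; rewrite /upd; case: eqVneq => [->|].
have updA (a : A) w : opol d c (upd x j ( *:%R a : M -> M)) w = 0.
  apply: IHl => i; rewrite /upd; case: eqVneq => [_|ij] il.
  - exact: opgen_scale.
  - by apply: ol; rewrite inE il orbT.
  - by exists a.
  - by apply: al; rewrite inE negb_or ij.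
elim: (ox j) v => [|a f b Sf _ IHb] v.
  have := updA 0 v; congr (opol _ _ _ _ = _).
  by congr upd; apply/funext => w; rewrite scale0r.
have [BL _ _ _] := opgen_algebra.
have oD b' : opgen b' -> {morph b' : u w / u + w}.
  by move=> /BL bL u w; have := bL 1 u w; rewrite !scale1r.
rewrite (@opol_upd k d V d c x j f ( *:%R a : M -> M) b) ?updA ?IHb.
- by rewrite addr0; apply: mod_endo0; apply: Sendo.
- by move=> e u w; apply: (Sendo Sf).
- exact: (scalerDr a).
- by move=> i _; apply: oD.
- by move=> i w _; apply: (opgen_commute w (ox i) Sf).
- by move=> w; rewrite mod_endoZ //; apply: Sendo.
- exact: cH.
Qed.

(** Jacobson density. If some [b] kills [us] but not [u], then [b u |-> b v], over the [b] killing
    [us], is a well-defined endomorphism [delta] commuting with [S]. By maximality [delta] is in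
    [S], and the induction hypothesis applies to [v - delta u]. *)
Lemma opgen_density (us : seq (opmod S)) (v : opmod S) :
    (forall b, opgen b -> (forall u, u \in us -> b u = 0) -> b v = 0) ->
  span setT us v.
Proof.
have [BL _ _ _] := opgen_algebra.
have oB b u w : opgen b -> b (u - w) = b u - b w.
  by move=> /BL bL; rewrite addrC -scaleN1r bL scaleN1r addrC.
have oid : opgen id.
  by have := opgen_scale 1; congr opgen; apply/funext => w; exact: (@scale1r A M).
elim: us v => [|u us IHus] v Hv; first exact: (Hv id oid).
have [Hu|/existsNP[b0 /not_implyP[ob0 /not_implyP[b0us b0u]]]] := pselect
    (forall b, opgen b -> (forall w, w \in us -> b w = 0) -> b u = 0).
  exists 0 => //; rewrite scale0r subr0; apply: IHus => b ob bus.
  by apply: Hv => // w; rewrite inE => /predU1P[->|/bus //]; apply: Hu.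
have /choice[beta Hb] : forall m : M, exists b,
    [/\ opgen b, forall w, w \in us -> b w = 0 & b u = m].
  move=> m; have [a Ea] := simple_module_gen Msimple b0u m.
  exists (fun w => a *: (b0 w : M)); split=> [|w /b0us ->|//].
    exact: opgenZ.
  exact: (@scaler0 A M).
pose delta (m : M) : M := beta m v.
have deltaE b : opgen b -> (forall w, w \in us -> b w = 0) -> delta (b u) = b v.
  move=> ob bus; have [ob' bus' E] := Hb (b u).
  apply/eqP; rewrite -subr_eq0; apply/eqP.
  have oN : opgen (fun w => (-1 : A) *: (b w : M)) by apply: opgenZ.
  have := Hv _ (opgenD ob' oN); rewrite scaleN1r; apply=> w.
  rewrite inE scaleN1r => /predU1P[->|wus]; first by rewrite E subrr.
  by rewrite (bus w wus) (bus' w wus) subr0.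
have deltaL : mod_endo delta.
  move=> a m n; have [om mus Em] := Hb m; have [on nus En] := Hb n.
  have := deltaE _ (opgenD (opgenZ a om) on); rewrite Em En; apply=> w wus.
  by rewrite mus // nus // addr0; apply: (@scaler0 A M).
have Sdelta : opf_set S delta.
  apply: Smax => // g Sg; apply/funext => m /=; have [om mus Em] := Hb m.
  have := deltaE _ (opgen_field Sg om); rewrite /= Em; apply=> w wus.
  by rewrite mus //; apply: mod_endo0; apply: Sendo.
exists (exist _ delta Sdelta) => //; apply: IHus => b ob bus.
transitivity (b v - b (delta u)); first exact: oB.
by rewrite (opgen_commute u ob Sdelta) (deltaE b) // subrr.
Qed.

Lemma scalar_op_closed (c : k) : opf_set S (fun v : M => c%:A *: v).
Proof.
apply: Smax => [a u v|g Sg]; last first.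
  by apply/funext => v /=; rewrite mod_endoZ //; apply: Sendo.
by rewrite scalerDr; congr (_ + _); apply/esym/(scaler_restrictA c a u).
Qed.

Definition scalar_op (c : k) : opfield S := exist _ _ (scalar_op_closed c).

Lemma scalar_op_zmod_morphism : zmod_morphism scalar_op.
Proof.
move=> c c'; apply: opfield_inj => v /=.
by rewrite !subrr !sub0r opprK scalerBl scalerBl.
Qed.

Lemma scalar_op_monoid_morphism : monoid_morphism scalar_op.
Proof.
split=> [|c c']; apply: opfield_inj => v /=; first by rewrite !scale1r.
by rewrite scalerA -scalerAl mul1r scalerA.
Qed.

HB.instance Definition _ := GRing.isZmodMorphism.Build k (opfield S) scalar_op
  scalar_op_zmod_morphism.
HB.instance Definition _ := GRing.isMonoidMorphism.Build k (opfield S) scalar_op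
  scalar_op_monoid_morphism.

End SimpleModule.

(** The identity yields finitely many vectors with zero annihilator in [opgen S]; by density they
    span [M] over the field [S]. Since [A] is affine and [M] simple, [S] is a finitely generated
    ring over [k], hence finite over [k] by [zariski]. *)
Lemma affine_pi_simple_fin_dim (k : fieldType) (A : algType k) (M : lmodType A) :
  affine A -> multilinear_identity A -> simple_module M -> fin_dim_module M.
Proof.
move=> [gens gensA] [d [c [cml Hc]]] Msimple.
have [S [Sendo Smax]] := exists_max_operator_field Msimple.
have [v0 v0n] : exists v : M, v <> 0 by case: Msimple.
have [||x Hx v|us Hus] := @opol_annihilator k d (restrict_scalars M) (opgen S)
    d c [::] (opgen_algebra Sendo) _ _ cml.1 cml.2 _.
- move=> u b un ob Hb v; have [a ->] := simple_module_gen Msimple un v.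
  by apply: (Hb _ (opgen_scale S a)).
- by exists v0.
- by apply: (opgen_identity Sendo cml Hc) => i; have [] := Hx i.
have spanS v : span (range (idfun : opfield S -> opfield S)) (us : seq (opmod S)) v.
  rewrite (_ : range _ = setT); last by apply/seteqP; split=> // x _; exists x.
  by apply: (opgen_density Msimple Sendo Smax) => b ob bus; apply: Hus.
pose kap : {rmorphism k -> opfield S} := scalar_op Sendo Smax.
have [||W [W0 WB WZ] WT [w Ww wn] v|l Hl] := @irreducible_scalars_generated
    (opfield S) (opfield S) idfun (opmod S) (range kap) (size gens)
    (fun t (v : opmod S) => (gens`_t *: (v : M) : opmod S)) us spanS.
- by exists v0.
- move=> t f u v; rewrite scalerDr; congr (_ + _).
  by apply/esym/mod_endoZ; exact: Sendo (svalP f).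
- have WD x y : W x -> W y -> W (x + y).
    by move=> Wx Wy; rewrite -[y]opprK; apply: (WB) => //; rewrite -sub0r; apply: WB.
  pose T := [set a : A | forall x : M, W x -> W (a *: x)].
  have /(gensA T) TA : subalgebra T.
    split=> [x|e a b Ta Tb x Wx|a b Ta Tb x Wx]; first by rewrite scale1r.
      rewrite scalerDl; apply: WD; last exact: Tb.
      rewrite -[a]mul1r scalerAl -scalerA.
      by apply: (WZ (kap e)); [exists (kap e) => //; exists e | apply: Ta].
    by rewrite -scalerA; apply/Ta/Tb.
  have [a ->] := simple_module_gen Msimple wn v.
  suff : T a by apply.
  rewrite TA // => y yg x Wx; have ly : (index y gens < size gens)%N by rewrite index_mem.
  by have := WT (Ordinal ly) x Wx; rewrite /= nth_index.
have [e' He'] := zariski Hl.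
have sR := subring_range kap.
have span_kap v : span (range kap) [seq y *: u | y <- e', u <- us : seq (opmod S)] v.
  apply: (@span_tower (opfield S) (opmod S) _ (range idfun) e' us) => [//|y _|].
    exact: He'.
  exact: spanS.
apply/fin_dimP; exists [seq y *: u | y <- e', u <- us : seq (opmod S)] => v.
move: (span_kap v); elim: [seq _ | _ <- _, _ <- _] v => [//|u e IHe] v /=.
by move=> [_ [a _ <-] /IHe Hv]; exists a.
Qed.

Theorem proposition3p12 (k : fieldType) :
  (forall A : algType k, fully_bounded_noetherian A ->
     [<-> fully_residually_fin_dim A;
          strongly_residually_fin_dim A;
          (forall M : lmodType A, simple_module M -> fin_dim_module M);
          (forall M : lmodType A^c, simple_module M -> fin_dim_module M);
          (forall I : proper_two_sided A, maximal_ideal I -> fin_dim (quot_alg I))])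
  /\
  (forall A : algType k, affine A -> noetherian A -> polynomial_identity A ->
     fully_residually_fin_dim A).
Proof.
split=> [A|A affA [noethA noethAc] /polynomial_multilinear_identity piA].
  exact: fbn_equivalences.
have affAc : affine A^c.
  have [g gA] := affA; exists g => S [S1 SL SM]; apply: gA; split=> // u v Su Sv.
  exact: (SM v u).
have piAc := converse_multilinear_identity piA.
split; apply: left_fully_rfd => //.
- exact: pi_faithful_nonessential.
- by apply/simple_fin_dimP => M; apply: affine_pi_simple_fin_dim.
- exact: pi_faithful_nonessential.
- by apply/simple_fin_dimP => M; apply: affine_pi_simple_fin_dim.
Qed.
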